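(* Consider Projected Stochastic Gradient Descent (PSGD) as defined below, with $\alpha_t=a/(u+t)^\gamma$ for some $a,u>0$ and $\gamma\in[0,1]$, and assume Conditions (D1) and (D2). Then there exist positive constants $J,I,K,L$ such that the following hold. - For all $t\ge0$ and $z\ge0$: $$\mathbb P\Big(\min_{x^\star\in\mathcal X^\star}\|x_{t+1}-x^\star\|\ge z\Big)\le J e^{-I t^\gamma z}.$$ - For all $t\ge1$: $$\mathbb E\Big[\min_{x^\star\in\mathcal X^\star}\|x_{t+1}-x^\star\|\Big]\le \frac{K}{t^\gamma} \qquad\text{and}\qquad \mathbb E\Big[l(x_{t+1})-\min_{x\in\mathcal X}l(x)\Big]\le\frac{L}{t^\gamma}.$$
   Context: $\mathcal X\subseteq\mathbb R^d$ is a nonempty closed bounded convex set, and $\|\cdot\|$ is the Euclidean norm. $l:\mathcal X\to\mathbb R$ is Lipschitz continuous, and $\mathcal X^\star:=\arg\min_{x\in\mathcal X}l(x)$. $\Pi_{\mathcal X}(y):=\arg\min_{z\in\mathcal X}\|y-z\|$ is the Euclidean projection. $\nabla l:\mathcal X\to\mathbb R^d$ denotes a fixed map giving the gradient (or a chosen subgradient) of $l$. PSGD: on a probability space with filtration $(\mathcal F_t)_{t\ge0}$, $x_0\in\mathcal X$ is $\mathcal F_0$-measurable, and for $t\ge0$ $$y_{t+1}=x_t-\alpha_t c_t,\qquad x_{t+1}=\Pi_{\mathcal X}(y_{t+1}),$$ where $c_t$ is an $\mathcal F_{t+1}$-measurable random vector with $\mathbb E[c_t\mid\mathcal F_t]=\nabla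 l(x_t)$. Condition (D1): there is $\kappa>0$ such that for every $x\in\mathcal X$ and every $x^\star\in\mathcal X^\star$ with $\|x-x^\star\|=\min_{z\in\mathcal X^\star}\|x-z\|$, $$\nabla l(x)^\top(x-x^\star)\ge\kappa\|x-x^\star\|.$$ Condition (D2): there are $\lambda>0$ and $M<\infty$ such that $\mathbb E[e^{\lambda\|c_t\|}\mid\mathcal F_t]\le M$ almost surely for all $t\ge0$. *)

(* Defs.v *)
From HB Require Import structures.
From mathcomp Require Import all_boot all_order all_algebra.
From mathcomp Require Import all_classical all_reals all_analysis.
Set Implicit Arguments. Unset Strict Implicit. Unset Printing Implicit Defensive.
Import Order.TTheory GRing.Theory Num.Theory.
Import numFieldNormedType.Exports.
Local Open Scope classical_set_scope.
Local Open Scope ring_scope.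

Section defs.
Variables (R : realType) (d : nat).

Definition E_dotv (u v : 'rV[R]_d) : R := \sum_(i < d) u ord0 i * v ord0 i.
Definition E_enorm (v : 'rV[R]_d) : R := Num.sqrt (E_dotv v v).

Definition E_convexR (X : set 'rV[R]_d) : Prop :=
  forall x y (th : R), X x -> X y -> 0 <= th -> th <= 1 ->
    X (th *: x + (1 - th) *: y).

Definition E_boundedR (X : set 'rV[R]_d) : Prop :=
  exists B : R, forall x, X x -> E_enorm x <= B.

Definition E_lipschitz_on (X : set 'rV[R]_d) (l : 'rV[R]_d -> R) : Prop :=
  exists C : R, forall x y, X x -> X y -> `|l x - l y| <= C * E_enorm (x - y).

Definition E_argmin_set (X : set 'rV[R]_d) (l : 'rV[R]_d -> R) : set 'rV[R]_d :=
  [set x | X x /\ forall z, X z -> l x <= l z].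

(* min_{z in S} ||x - z|| (written as an infimum; the minimum is attained
   whenever S is nonempty and closed) *)
Definition E_dist_to (S : set 'rV[R]_d) (x : 'rV[R]_d) : R :=
  inf [set E_enorm (x - z) | z in S].

Definition E_min_val (X : set 'rV[R]_d) (l : 'rV[R]_d -> R) : R :=
  inf [set l x | x in X].

Definition E_is_proj (X : set 'rV[R]_d) (v y : 'rV[R]_d) : Prop :=
  X y /\ forall z, X z -> E_enorm (v - y) <= E_enorm (v - z).
End defs.

Section prob.
Variables (dT : measure_display) (T : measurableType dT) (R : realType).

Definition E_sub_sigma (G : set (set T)) : Prop :=
  sigma_algebra setT G /\ G `<=` measurable.

Definition E_filtration (F : nat -> set (set T)) : Prop :=
  (forall t, E_sub_sigma (F t)) /\ (forall s t, (s <= t)%N -> F s `<=` F t).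

Definition E_measurable_wrt d (G : set (set T)) (f : T -> 'rV[R]_d) : Prop :=
  forall (i : 'I_d) (B : set R), measurable B -> G ((fun w => f w ord0 i) @^-1` B).

(* E[f | G] = g a.s., for vector-valued f, g (g G-measurable), written via the
   defining property of conditional expectation *)
Definition E_cond_exp_eq d (P : probability T R) (G : set (set T))
    (f g : T -> 'rV[R]_d) : Prop :=
  E_measurable_wrt G g /\
  forall i : 'I_d,
    P.-integrable setT (fun w => (f w ord0 i)%:E) /\
    P.-integrable setT (fun w => (g w ord0 i)%:E) /\
    forall A, G A ->
      (\int[P]_(w in A) (f w ord0 i)%:E = \int[P]_(w in A) (g w ord0 i)%:E)%E.

(* E[h | G] <= M a.s., for a nonnegative h, written via the defining property
   of conditional expectation: for all A in G, E[h 1_A] <= M P(A) *)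
Definition E_cond_exp_le (P : probability T R) (G : set (set T))
    (h : T -> R) (M : R) : Prop :=
  forall A, G A -> (\int[P]_(w in A) (h w)%:E <= M%:E * P A)%E.
End prob.

(* Main.v *)
(* Let S be the set of minimizers, d_t the distance of x_t to S, p a nearest point.
   Since |x_{t+1} - p| <= |x_t - alpha_t c_t - p|, Condition (D1) gives d_t a drift of at
   most - kappa alpha_t / 2 as soon as d_t >= r alpha_t, and (D2) controls the exponential
   moments of its increments; hence, for theta alpha_t <= eta small,
     E exp(theta d_{t+1}) <= (1 - kappa theta alpha_t / 2) E exp(theta d_t) + const.
   To bound d_{t+1}, this is iterated with the FIXED exponent theta = eta / alpha_n over a
   window [n, t] with n = t / B: there theta alpha_s stays between two positive constants,
   and since alpha_s >= a / (u + 1 + s) the sum of the steps over the window exceeds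
   2 diam(X) / kappa when B is large, which cancels the initial value exp(theta diam(X)).
   So E exp(I t^gamma d_{t+1}) is bounded uniformly in t, and the three estimates follow
   from Markov's inequality, from y <= exp y, and from the Lipschitz continuity of l. *)
Require Import Defs.
From HB Require Import structures.
From mathcomp Require Import all_boot all_order all_algebra.
From mathcomp Require Import all_classical all_reals all_analysis.
From mathcomp Require Import measurable_realfun ring lra.
Set Implicit Arguments. Unset Strict Implicit. Unset Printing Implicit Defensive.
Import Order.TTheory GRing.Theory Num.Theory.
Import numFieldNormedType.Exports.
Local Open Scope classical_set_scope.
Local Open Scope ring_scope.

(** * Euclidean geometry *)

Section euclidean_norm.
Variables (R : realType) (d : nat).
Implicit Types (u v w g : 'rV[R]_d) (X : set 'rV[R]_d).

Lemma dotC u v : E_dotv u v = E_dotv v u.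
Proof. by apply: eq_bigr => i _; rewrite mulrC. Qed.

Lemma dotDl u v w : E_dotv (u + v) w = E_dotv u w + E_dotv v w.
Proof. by rewrite /E_dotv -big_split; apply: eq_bigr => i _ /=; rewrite mxE mulrDl. Qed.

Lemma dotZl a u w : E_dotv (a *: u) w = a * E_dotv u w.
Proof. by rewrite /E_dotv mulr_sumr; apply: eq_bigr => i _; rewrite mxE mulrA. Qed.

Lemma dotNl u w : E_dotv (- u) w = - E_dotv u w.
Proof. by rewrite -scaleN1r dotZl mulN1r. Qed.

Lemma dotDr u v w : E_dotv w (u + v) = E_dotv w u + E_dotv w v.
Proof. by rewrite !(dotC w) dotDl. Qed.

Lemma dotZr a u w : E_dotv w (a *: u) = a * E_dotv w u.
Proof. by rewrite !(dotC w) dotZl. Qed.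

Lemma dotNr u w : E_dotv w (- u) = - E_dotv w u.
Proof. by rewrite !(dotC w) dotNl. Qed.

Definition dotE := (dotDl, dotDr, dotZl, dotZr, dotNl, dotNr).

Lemma enorm_ge0 v : 0 <= E_enorm v. Proof. exact: sqrtr_ge0. Qed.

Lemma dotvv_ge0 v : 0 <= E_dotv v v.
Proof. by apply: sumr_ge0 => i _; rewrite -expr2 sqr_ge0. Qed.

Lemma enorm_sq v : E_enorm v ^+ 2 = E_dotv v v.
Proof. by rewrite sqr_sqrtr// dotvv_ge0. Qed.

Lemma enorm0 : E_enorm (0 : 'rV[R]_d) = 0.
Proof.
by rewrite /E_enorm /E_dotv big1 ?sqrtr0// => i _; rewrite mxE mulr0.
Qed.

Lemma enormN v : E_enorm (- v) = E_enorm v.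
Proof. by rewrite /E_enorm dotNl dotNr opprK. Qed.

Lemma enormB v w : E_enorm (v - w) = E_enorm (w - v).
Proof. by rewrite -opprB enormN. Qed.

Lemma coord_le_enorm v i : `|v ord0 i| <= E_enorm v.
Proof.
rewrite -sqrtr_sqr ler_sqrt ?dotvv_ge0// /E_dotv (bigD1 i)//= expr2 lerDl.
by apply: sumr_ge0 => j _; rewrite -expr2 sqr_ge0.
Qed.

(** The sum of absolute coordinates replaces the Euclidean norm of [g] because its integrability
    follows directly from that of the coordinates; it later controls the error made by changing the
    direction [w]. *)
Lemma dot_le_l1 g w : `|E_dotv g w| <= (\sum_(i < d) `|g ord0 i|) * E_enorm w.
Proof.
rewrite mulr_suml; apply: (le_trans (ler_norm_sum _ _ _)).
by apply: ler_sum => i _; rewrite normrM ler_wpM2l// coord_le_enorm.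
Qed.

Lemma enorm_le_l1 v : E_enorm v <= \sum_(i < d) `|v ord0 i|.
Proof.
have := dot_le_l1 v v; rewrite -enorm_sq ger0_norm ?sqr_ge0// expr2.
have := enorm_ge0 v; rewrite le_eqVlt => /orP[/eqP<- _|v0].
  by apply: sumr_ge0.
by rewrite ler_pM2r.
Qed.

(** Cauchy-Schwarz: expand the square of [|v| u - |u| v] and divide by [|u| |v|]; a zero norm forces
    all coordinates to vanish and is treated apart. *)
Lemma dot_le_enorm u v : E_dotv u v <= E_enorm u * E_enorm v.
Proof.
have := dotvv_ge0 (E_enorm v *: u - E_enorm u *: v).
rewrite !dotE -!enorm_sq (dotC v u).
have := enorm_ge0 u; rewrite le_eqVlt => /orP[/eqP u0 _|u0].
  rewrite -u0 mul0r /E_dotv big1// => i _.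
  by have := coord_le_enorm u i; rewrite -u0 normr_le0 => /eqP ->; rewrite mul0r.
have := enorm_ge0 v; rewrite le_eqVlt => /orP[/eqP v0 _|v0 H].
  rewrite -v0 mulr0 /E_dotv big1// => i _.
  by have := coord_le_enorm v i; rewrite -v0 normr_le0 => /eqP ->; rewrite mulr0.
have uv := mulr_gt0 u0 v0.
rewrite -(ler_pM2l uv); nra.
Qed.

Lemma enorm_triangle u v : E_enorm (u + v) <= E_enorm u + E_enorm v.
Proof.
rewrite -ler_sqr ?nnegrE ?addr_ge0 ?enorm_ge0//.
rewrite sqrrD !enorm_sq !dotE (dotC v u).
have := dot_le_enorm u v; lra.
Qed.

Lemma enorm_triangle3 u v w : E_enorm (u - w) <= E_enorm (u - v) + E_enorm (v - w).
Proof. by apply: le_trans (enorm_triangle _ _); rewrite addrA subrK. Qed.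

(* AM-GM : N <= (N^2 + |v|^2) / (2 |v|) *)
Lemma enorm_subZ_le v c (al : R) : 0 < E_enorm v ->
  E_enorm (v - al *: c) <=
  E_enorm v - al * (E_dotv c v / E_enorm v) + al ^+ 2 * E_enorm c ^+ 2 / (2 * E_enorm v).
Proof.
move=> v0.
have : E_enorm (v - al *: c) ^+ 2 = E_enorm v ^+ 2 - 2 * al * E_dotv c v + al ^+ 2 * E_enorm c ^+ 2.
  by rewrite !enorm_sq !dotE (dotC v c); ring.
move: (E_enorm (v - _)) (E_dotv c v) (E_enorm c ^+ 2) => N D C NE.
rewrite -(ler_pM2r (x := 2 * E_enorm v)) ?mulr_gt0//.
have -> : (E_enorm v - al * (D / E_enorm v) + al ^+ 2 * C / (2 * E_enorm v)) *
    (2 * E_enorm v) = 2 * E_enorm v ^+ 2 - 2 * al * D + al ^+ 2 * C.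
  by field; rewrite gt_eqF.
have := sqr_ge0 (N - E_enorm v); rewrite sqrrB; lra.
Qed.

(** If the inner product [D] were positive, moving from [y] slightly towards [z] would stay in [X]
    and come strictly closer to [v]. *)
Lemma proj_variational X v y z : E_convexR X -> E_is_proj X v y -> X z ->
  E_dotv (v - y) (z - y) <= 0.
Proof.
move=> cX [Xy vy] Xz; rewrite leNgt; apply/negP => D0.
set D := E_dotv _ _ in D0.
set N := E_enorm (z - y) ^+ 2.
have N0 : 0 <= N by apply: sqr_ge0.
(* This step lies in (0, 1] and satisfies [th * N <= D], so the squared distance changes by
   [- 2 th D + th^2 N <= - th D < 0]. The denominator is positive even when [N = 0]. *)
pose th := D / (N + D).
have ND : 0 < N + D by lra.
have th0 : 0 < th by rewrite divr_gt0.
have th1 : th <= 1 by rewrite ler_pdivrMr//; lra.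
have := vy _ (cX z y th Xz Xy (ltW th0) th1).
rewrite -ler_sqr ?nnegrE ?enorm_ge0//.
have -> : v - (th *: z + (1 - th) *: y) = (v - y) - th *: (z - y).
  by rewrite scalerBl scale1r scalerBr; apply/rowP => i; rewrite !mxE; ring.
have E (p q : 'rV[R]_d) : E_enorm (p - th *: q) ^+ 2 =
    E_enorm p ^+ 2 - 2 * th * E_dotv p q + th ^+ 2 * E_enorm q ^+ 2.
  by rewrite !enorm_sq !dotE (dotC q p); ring.
rewrite E -/D -/N.
have : th * N <= D.
  by rewrite /th mulrAC ler_pdivrMr//; nra.
nra.
Qed.

(** Adding the two variational inequalities bounds [|y - y'|^2] by the inner product of [v - v'] and
    [y - y']; Cauchy-Schwarz concludes. *)
Lemma proj_nonexpansive X v y v' y' : E_convexR X ->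
  E_is_proj X v y -> E_is_proj X v' y' -> E_enorm (y - y') <= E_enorm (v - v').
Proof.
move=> cX P P'.
have := proj_variational cX P P'.1; have := proj_variational cX P' P.1.
have := dot_le_enorm (v - v') (y - y').
have := enorm_sq (y - y'); rewrite !dotE.
have := (dotC y' y, dotC y v, dotC y' v, dotC y v', dotC y' v').
case=> [[[[C1 C2] C3] C4] C5] E H1 H2 H3.
have := enorm_ge0 (y - y'); rewrite le_eqVlt => /orP[/eqP<-|N0].
  exact: enorm_ge0.
by rewrite -(ler_pM2r N0) -expr2; lra.
Qed.

Lemma proj_dist_le X v y p : E_convexR X -> E_is_proj X v y -> X p ->
  E_enorm (y - p) <= E_enorm (v - p).
Proof.
move=> cX P Xp; apply: (proj_nonexpansive cX P); split=> // z _.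
by rewrite subrr enorm0 enorm_ge0.
Qed.

Lemma enorm_continuous (x : 'rV[R]_d) : continuous (fun z : 'rV[R]_d => E_enorm (x - z)).
Proof.
move=> z; apply: (@continuous_comp _ _ _ (fun z : 'rV[R]_d => E_dotv (x - z) (x - z)) Num.sqrt); last exact: sqrt_continuous.
apply: (@cvg_big _ _ _ _ _ add_continuous _ _ _ _ _ (@nbhs_filter _ z)) => i _ /=.
have C : (x - z') ord0 i @[z' --> z] --> (x - z) ord0 i.
  under eq_fun do rewrite !mxE; rewrite !mxE.
  by apply: (@cvgB _ _ _ _ (nbhs_filter z) (fun=> x ord0 i) (fun z' : 'rV[R]_d => z' ord0 i)); [exact: cvg_cst | exact: coord_continuous].
exact: cvgM.
Qed.

(** The ambient norm on row vectors is the max norm, which is at most the Euclidean one. *)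
Lemma boundedR_closed_compact X : closed X -> E_boundedR X -> compact X.
Proof.
move=> cX [B XB]; apply: bounded_closed_compact => //.
exists `|B|; split=> // M BM v Xv /=.
rewrite /Num.norm /= mx_normrE; apply: bigmax_le => [|[i j] _ /=].
  by rewrite (le_trans (normr_ge0 B))// ltW.
rewrite ord1 (le_trans (coord_le_enorm _ _))// (le_trans (XB _ Xv))//.
by rewrite (le_trans (ler_norm B))// ltW.
Qed.

End euclidean_norm.

(** * Distance to a set *)

Section distance.
Variables (R : realType) (d : nat).
Implicit Types (S X : set 'rV[R]_d) (x y z : 'rV[R]_d).

Lemma dist_to_ge0 S x : 0 <= E_dist_to S x.
Proof.
have [->|S0] := eqVneq S set0; first by rewrite /E_dist_to image_set0 inf0.
apply: lb_le_inf; last by move=> _ [z _ <-]; exact: enorm_ge0.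
by have /set0P[z Sz] := S0; exists (E_enorm (x - z)); exists z.
Qed.

Lemma dist_to_le S x z : S z -> E_dist_to S x <= E_enorm (x - z).
Proof.
move=> Sz; apply: ge_inf; last by exists z.
by exists 0 => _ [y _ <-]; exact: enorm_ge0.
Qed.

Lemma dist_to_lipschitz S x y : E_dist_to S x <= E_dist_to S y + E_enorm (x - y).
Proof.
have [->|/set0P[s Ss]] := eqVneq S set0.
  by rewrite /E_dist_to !image_set0 inf0 add0r enorm_ge0.
rewrite -lerBlDr; apply: lb_le_inf; first by exists (E_enorm (y - s)); exists s.
move=> _ [z Sz <-]; rewrite lerBlDr addrC.
exact: le_trans (dist_to_le _ Sz) (enorm_triangle3 _ _ _).
Qed.

Lemma dist_to_attained S x : S !=set0 -> compact S ->
  exists2 p, S p & E_enorm (x - p) = E_dist_to S x.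
Proof.
move=> S0 cS.
have [|p] := @EVT_min_rV R d (fun z : 'rV[R]_d => E_enorm (x - z)) S S0 cS.
  exact/continuous_subspaceT/enorm_continuous.
rewrite inE => Sp pmin; exists p => //; apply/eqP; rewrite eq_le dist_to_le// andbT.
apply: lb_le_inf; first by exists (E_enorm (x - p)); exists p.
by move=> _ [z Sz <-]; apply: pmin; rewrite inE.
Qed.

End distance.

(** * Measurability with respect to a sub-sigma-algebra *)

Section grid.
Variables (R : realType) (d : nat).
Implicit Types (e : R) (k : 'rV[int]_d) (y z : 'rV[R]_d).

(** A countable net of mesh [e]. The boxes around its points overlap; only the fact that they cover
    the space is used, to turn conditions on real vectors into countable unions. *)
Definition grid e k : 'rV[R]_d := \row_i (e * (k ord0 i)%:~R).

Definition grid_box e k : set 'rV[R]_d :=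
  [set y | forall i, `|y ord0 i - grid e k ord0 i| <= e].

Lemma grid_box_cover e y : 0 < e -> exists k, grid_box e k y.
Proof.
move=> e0; exists (\row_i Num.floor (y ord0 i / e)) => i; rewrite !mxE.
have /andP[H1 H2] := mem_rg1_floor (y ord0 i / e).
set k := (Num.floor _)%:~R in H1 H2 *.
rewrite -(divfK (lt0r_neq0 e0) (y ord0 i)).
move: (y ord0 i / e) H1 H2 => t H1 H2.
have -> : t * e - e * k = e * (t - k) by ring.
have H3 : t - k < 1 by move: H2; rewrite ?intrD ?rmorphD /= -/k; lra.
by rewrite ger0_norm; [|apply: mulr_ge0; lra]; nra.
Qed.

Lemma grid_box_center e k y : grid_box e k y -> E_enorm (y - grid e k) <= d%:R * e.
Proof.
move=> yk; apply: le_trans (enorm_le_l1 _) _.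
rewrite mulr_natl -[X in _ *+ X]card_ord -sumr_const.
by apply: ler_sum => i _; have := yk i; rewrite !mxE.
Qed.

Lemma closed_enorm_ball (c : 'rV[R]_d) (r : R) : closed [set z : 'rV[R]_d | E_enorm (c - z) <= r].
Proof.
apply: (@preimage_closed _ _ (fun z : 'rV[R]_d => E_enorm (c - z)) [set s | s <= r]).
  by move=> z _; exact: enorm_continuous.
exact: closed_le.
Qed.

End grid.

Section sub_sigma_algebra.
Variables (R : realType) (d : nat) (dT : measure_display) (T : measurableType dT).
Variables (G : set (set T)) (sG : sigma_algebra setT G).

(** A sigma-algebra generates itself, so the measurable sets of [g_sigma_algebraType G] are those of
    [G] and the general theory of measurable functions applies to [G]. *)
Let measurableG (A : set T) : measurable (A : set (g_sigma_algebraType G)) = G A.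
Proof. by rewrite /measurable /= sigma_algebra_id. Qed.

Definition sub_measurable (f : T -> R) := forall B, measurable B -> G (f @^-1` B).

Lemma sub_measurableP (f : T -> R) :
  sub_measurable f <-> measurable_fun setT (f : g_sigma_algebraType G -> R).
Proof.
split=> mf; first by move=> _ B mB; rewrite setTI measurableG; exact: mf.
by move=> B mB; rewrite -measurableG -[X in measurable X]setTI; apply: mf.
Qed.

Lemma sub_bigcup (U : countType) (F : U -> set T) :
  (forall k, G (F k)) -> G (\bigcup_k F k).
Proof.
move=> GF; rewrite -measurableG; apply: countable_bigcupT_measurable => // k.
by rewrite measurableG.
Qed.

Lemma sub_bigcap_ord n (F : 'I_n -> set T) : (forall k, G (F k)) -> G (\bigcap_k F k).
Proof.
move=> GF; rewrite -measurableG; apply: fin_bigcap_measurable => // k _.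
by rewrite measurableG.
Qed.

Lemma sub_setI A B : G A -> G B -> G (A `&` B).
Proof. by rewrite -!measurableG; exact: measurableI. Qed.

Lemma sub_setC A : G A -> G (~` A).
Proof. by rewrite -!measurableG; exact: measurableC. Qed.

Lemma sub_set0 : G set0.
Proof. by rewrite -!measurableG; exact: measurable0. Qed.

Lemma sub_setT : G setT.
Proof. by rewrite -!measurableG; exact: measurableT. Qed.

Lemma sub_measurableB f g : sub_measurable f -> sub_measurable g ->
  sub_measurable (fun w => f w - g w).
Proof. by rewrite !sub_measurableP; exact: measurable_funB. Qed.

Lemma sub_measurableZ a f : sub_measurable f -> sub_measurable (fun w => a * f w).
Proof. by rewrite !sub_measurableP => mf; apply: measurable_funM. Qed.

Variables (Y : T -> 'rV[R]_d) (mY : E_measurable_wrt G Y).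

Lemma sub_grid_box e k : G (Y @^-1` grid_box e k).
Proof.
have -> : Y @^-1` grid_box e k = \bigcap_i (fun w => Y w ord0 i) @^-1`
    [set` `[grid e k ord0 i - e, grid e k ord0 i + e]].
  apply/seteqP; split=> w /= H i; last first.
    by have := H i Logic.I; rewrite /= in_itv/= ler_distl.
  by move=> _; rewrite /= in_itv/= -ler_distl; exact: H.
by apply: sub_bigcap_ord => i; apply: mY.
Qed.

(** The hypothesis makes [f] a Lipschitz function of [Y] without naming that function. Then [f < r]
    is the countable union of the preimages of those boxes on which [f < r] holds throughout. *)
Lemma lipschitz_sub_measurable (f : T -> R) (L : R) :
  (forall w w', f w - f w' <= L * E_enorm (Y w - Y w')) -> sub_measurable f.
Proof.
move=> fL; apply/sub_measurableP.
apply: (measurability _ (RGenInftyO.measurableE R)) => _ [_ [r ->] <-].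
rewrite setTI measurableG.
pose good (p : nat * 'rV[int]_d) := forall w, grid_box p.1.+1%:R^-1 p.2 (Y w) -> f w < r.
have -> : f @^-1` `]-oo, r[ = \bigcup_(p : nat * 'rV[int]_d)
    (if `[< good p >] then Y @^-1` grid_box p.1.+1%:R^-1 p.2 else set0).
  apply/seteqP; split=> w /=; rewrite in_itv /=; last first.
    by move=> [p _]; case: asboolP => // gp; exact: gp.
  move=> fr.
  have Ld0 : 0 <= `|L| * (2 * d%:R) by rewrite mulr_ge0// mulr_ge0.
  (* Two points of a box of mesh [e] are at distance at most [2 d e], so on this mesh [f] rises by
     less than the gap [r - f w]. *)
  have [n nr] : exists n : nat, `|L| * (2 * d%:R) * n.+1%:R^-1 < r - f w.
    exists (Num.truncn (`|L| * (2 * d%:R) / (r - f w))).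
    rewrite ltr_pdivrMr// [ltRHS]mulrC -ltr_pdivrMr ?subr_gt0//.
    exact: truncnS_gt.
  have n0 : 0 < n.+1%:R^-1 :> R by rewrite invr_gt0.
  have [k wk] := grid_box_cover (Y w) n0.
  exists (n, k) => //; case: asboolP => // -[] w' /= w'k.
  rewrite -(ltrD2r (- f w)); apply: le_lt_trans nr.
  apply: le_trans (fL w' w) _.
  apply: (@le_trans _ _ (`|L| * E_enorm (Y w' - Y w))).
    by rewrite ler_wpM2r ?enorm_ge0// ler_norm.
  rewrite -mulrA ler_wpM2l//.
  apply: le_trans (enorm_triangle3 _ (grid n.+1%:R^-1 k) _) _.
  rewrite (enormB (grid _ _)).
  have := grid_box_center w'k; have := grid_box_center wk.
  move: (n.+1%:R^-1) (d%:R) => e D. nra.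
apply: sub_bigcup => p; case: asboolP => _; [exact: sub_grid_box|exact: sub_set0].
Qed.

End sub_sigma_algebra.

(** * One step of the recursion *)

Section exponential_bounds.
Variable R : realType.
Let eq_ler (a b : R) : a = b -> a <= b. Proof. by move->. Qed.
Implicit Types y lam h r : R.

(** From [exp y - 1 <= y exp y], used twice when [y >= 0]; when [y < 0] the second use is replaced
    by [exp y - 1 >= y]. *)
Lemma expR_le_quadratic y : expR y <= 1 + y + y ^+ 2 * expR `|y|.
Proof.
have Ey : expR y - 1 <= y * expR y.
  have := expR_ge1Dx (- y); rewrite -(ler_pM2l (expR_gt0 y)) -expRD subrr expR0; lra.
have E0 := expR_ge1Dx y.
have [y0|y0] := leP 0 y.
  have : y * (expR y - 1) <= y * (y * expR y) by rewrite ler_wpM2l.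
  by rewrite ger0_norm//; lra.
have E1 : 1 <= expR `|y| by rewrite -expR0 ler_expR.
have : y ^+ 2 * 1 <= y ^+ 2 * expR `|y| by rewrite ler_wpM2l// sqr_ge0.
have := expR_gt0 y; nra.
Qed.

(** Square [z <= exp z] at [z = lam * y / 4]. Only half of the exponent [lam] is spent: the other
    half pays for the factor [exp |y|] of the quadratic remainder. *)
Lemma sqr_le_expR lam y : 0 < lam -> 0 <= y ->
  y ^+ 2 <= 16 / lam ^+ 2 * expR (lam / 2 * y).
Proof.
move=> lam0 y0.
have -> : lam / 2 * y = lam / 4 * y + lam / 4 * y by field.
have := expR_ge1Dx (lam / 4 * y); rewrite expRD -expr2.
have z0 : 0 <= lam / 4 * y by rewrite mulr_ge0 ?divr_ge0// ltW.
move=> E; rewrite -[leLHS]mul1r mulrAC ler_pdivlMr ?exprn_gt0// mul1r.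
apply: (@le_trans _ _ (16 * (lam / 4 * y) ^+ 2)); first by apply: eq_ler; field.
by rewrite ler_pM2l// ler_sqr ?nnegrE ?expR_ge0//; lra.
Qed.

(** Second-order expansion of the exponential at [y], which is [th] times the increment of the norm.
    The curvature of the norm yields the [r^-1] term, the quadratic remainder the [th * al] term. *)
Lemma expR_step d (v c : 'rV[R]_d) al th lam r :
  0 < al -> 0 < th -> 0 < r -> 0 < lam -> th * al <= lam / 2 ->
  r * al / 2 <= E_enorm v ->
  expR (th * E_enorm (v - al *: c)) <= expR (th * E_enorm v) *
    (1 - th * al * E_dotv c ((E_enorm v)^-1 *: v) +
     th * al * ((r^-1 + th * al) * (16 / lam ^+ 2)) * expR (lam * E_enorm c)).
Proof.
move=> al0 th0 r0 lam0 hlam vr.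
have v0 : 0 < E_enorm v by apply: lt_le_trans vr; rewrite divr_gt0// mulr_gt0.
set C := E_enorm c; have C0 : 0 <= C by exact: enorm_ge0.
set h := th * al in hlam *; have h0 : 0 < h by rewrite mulr_gt0.
set y := th * (E_enorm (v - al *: c) - E_enorm v).
have -> : th * E_enorm (v - al *: c) = th * E_enorm v + y by rewrite /y; ring.
rewrite expRD ler_pM2l ?expR_gt0//.
have yh : `|y| <= h * C.
  rewrite normrM gtr0_norm// -mulrA ler_pM2l//.
  have EaC : E_enorm (al *: c) = al * C.
    by rewrite /C /E_enorm dotZl dotZr mulrA -expr2 sqrtrM ?sqr_ge0// sqrtr_sqr gtr0_norm.
  rewrite ler_norml -EaC; apply/andP; split.
    have := enorm_triangle (v - al *: c) (al *: c); rewrite subrK; lra.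
  by have := enorm_triangle v (- (al *: c)); rewrite enormN; lra.
apply: le_trans (expR_le_quadratic y) _.
have S := sqr_le_expR lam0 C0.
set B := 16 / lam ^+ 2 in S *.
have B0 : 0 < B by rewrite divr_gt0// exprn_gt0.
have y1 : y <= - h * E_dotv c ((E_enorm v)^-1 *: v) + h * r^-1 * C ^+ 2.
  rewrite /y dotZr (mulrC _^-1).
  have := enorm_subZ_le c al v0; rewrite -/C => H.
  (* Being at distance at least [r * al / 2] from the origin makes this curvature term of order [al]
     with the small factor [r^-1]. *)
  have H2 : al ^+ 2 * C ^+ 2 / (2 * E_enorm v) <= al * r^-1 * C ^+ 2.
    rewrite ler_pdivrMr ?mulr_gt0//.
    apply: (@le_trans _ _ (al * r^-1 * C ^+ 2 * (2 * (r * al / 2)))).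
      by apply: eq_ler; field; rewrite gt_eqF.
    apply: ler_wpM2l; last by rewrite ler_pM2l.
    by apply/mulr_ge0/sqr_ge0/mulr_ge0; rewrite ?invr_ge0 ltW.
  have : th * (E_enorm (v - al *: c) - E_enorm v) <=
         th * (- al * (E_dotv c v / E_enorm v) + al * r^-1 * C ^+ 2).
    by rewrite ler_pM2l//; lra.
  by move/le_trans; apply; rewrite /h; apply: eq_ler; ring.
have hC : h * C <= lam / 2 * C by rewrite ler_wpM2r.
have q1 : C ^+ 2 <= B * expR (lam * C).
  apply: le_trans S _; rewrite ler_pM2l// ler_expR.
  have : 0 <= lam * C by rewrite mulr_ge0// ltW. lra.
have q2 : y ^+ 2 * expR `|y| <= h ^+ 2 * (B * expR (lam * C)).
  have -> : lam * C = lam / 2 * C + lam / 2 * C by field.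
  rewrite expRD (mulrA B) mulrA; apply: ler_pM.
  - exact: sqr_ge0.
  - exact: expR_ge0.
  - apply: (@le_trans _ _ (h ^+ 2 * C ^+ 2)).
      by rewrite -exprMn -real_normK ?num_real// ler_sqr ?nnegrE// mulr_ge0// ltW.
    by rewrite ler_wpM2l// sqr_ge0.
  - by rewrite ler_expR; apply: le_trans hC.
have q3 : h * r^-1 * C ^+ 2 <= h * r^-1 * (B * expR (lam * C)).
  by rewrite ler_wpM2l// ltW// divr_gt0.
apply: (@le_trans _ _ (1 + (- h * E_dotv c ((E_enorm v)^-1 *: v) + h * r^-1 * (B * expR (lam * C))) + h ^+ 2 * (B * expR (lam * C)))).
  by lra.
by apply: eq_ler; ring.
Qed.

End exponential_bounds.

(** * Conditional drift of the exponential of the distance *)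

Section one_step.
Variables (R : realType) (dT : measure_display) (T : measurableType dT).
Variable (P : probability T R).
Variables (G : set (set T)) (sG : E_sub_sigma G).

Let sigG : sigma_algebra setT G := sG.1.
Let mG A : G A -> measurable A. Proof. exact: sG.2. Qed.

Lemma sub_measurable_fun (f : T -> R) D : sub_measurable G f -> measurable D -> measurable_fun D f.
Proof. by move=> mf mD _ B mB; apply: measurableI => //; apply: mG; apply: mf. Qed.

(** The cells are made disjoint inside [G] and the integrals summed. The comparison is assumed on
    every subset in [G] of a cell so that it survives this operation. *)
Lemma le_integral_cover (f g : T -> R) (C : nat -> set T) (N : set T) :
  measurable_fun setT f -> measurable_fun setT g ->
  (forall w, 0 <= f w) -> (forall w, 0 <= g w) ->
  G N -> (forall k, G (C k)) -> N `<=` \bigcup_k C k ->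
  (forall k A, G A -> A `<=` C k -> A `<=` N ->
    (\int[P]_(w in A) (f w)%:E <= \int[P]_(w in A) (g w)%:E)%E) ->
  (\int[P]_(w in N) (f w)%:E <= \int[P]_(w in N) (g w)%:E)%E.
Proof.
move=> mf mg f0 g0 GN GC NC H.
pose F := seqDU (fun k => N `&` C k).
have GF k : G (F k).
  rewrite /F /seqDU setDE; apply: (sub_setI sigG); first exact: (sub_setI sigG).
  apply: (sub_setC sigG); elim/big_ind: _ => [|A B GA GB|i _].
  - exact: (sub_set0 sigG).
  - by rewrite -[A]setCK -[B]setCK -setCI; do !apply/(sub_setC sigG)=> //; apply: (sub_setI sigG); apply: (sub_setC sigG).
  - exact: (sub_setI sigG).
have NE : N = \bigcup_k F k.
  rewrite -seqDU_bigcup_eq; apply/seteqP; split=> w; last by move=> [k _ []].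
  by move=> Nw; have [k _ Ck] := NC w Nw; exists k.
have FN k : F k `<=` N by rewrite NE; exact: bigcup_sup.
have FC k : F k `<=` C k by move=> w [[]].
rewrite NE !ge0_integral_bigcup//.
- by apply: lee_nneseries => k *; [apply: integral_ge0 => w _; rewrite lee_fin|exact: H].
- by move=> k; exact: mG.
- by rewrite -NE; apply/measurable_EFinP; exact: measurable_funTS.
- by move=> w _; rewrite lee_fin.
- exact: trivIset_seqDU.
- by move=> k; exact: mG.
- by rewrite -NE; apply/measurable_EFinP; exact: measurable_funTS.
- by move=> w _; rewrite lee_fin.
- exact: trivIset_seqDU.
Qed.

(* [Y], [c], [g] and [D'] stand for x_t, c_t, grad l (x_t) and the distance of x_{t+1}
   to the set of minimizers [S]. *)
Variables (d : nat) (Y c g : T -> 'rV[R]_d) (S : set 'rV[R]_d) (D' : T -> R).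
Variables (kappa lam M al th r Dmax : R).
Hypotheses (mY : E_measurable_wrt G Y) (S0 : S !=set0) (cS : compact S).
Hypotheses (mc : forall i, measurable_fun setT (fun w => c w ord0 i)).
Hypotheses (cg : E_cond_exp_eq P G c g).
Hypotheses (cM : E_cond_exp_le P G (fun w => expR (lam * E_enorm (c w))) M).
Hypotheses (drift : forall w p, S p -> E_enorm (Y w - p) = E_dist_to S (Y w) ->
  kappa * E_enorm (Y w - p) <= E_dotv (g w) (Y w - p)).
Hypotheses (mD' : measurable_fun setT D')
  (D'le : forall w p, S p -> D' w <= E_enorm (Y w - al *: c w - p)).
Hypotheses (Ymax : forall w, E_dist_to S (Y w) <= Dmax).
Hypotheses (kappa0 : 0 < kappa) (lam0 : 0 < lam) (al0 : 0 < al) (th0 : 0 < th) (r0 : 0 < r).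
Let h := th * al.
(** The coefficient left by [expR_step], up to the factor [h]. Hypothesis [kM] lets the second-order
    term consume at most half of the drift, and [hkappa] keeps the rate [1 - h * kappa / 2]
    nonnegative. *)
Let k0 := (r^-1 + h) * (16 / lam ^+ 2).
Hypotheses (hlam : h <= lam / 2) (hkappa : h <= kappa^-1) (kM : k0 * M <= kappa / 2).

Let dist w := E_dist_to S (Y w).
Let l1 w := \sum_(i < d) `|g w ord0 i|.

Lemma sub_measurable_dist : sub_measurable G dist.
Proof.
apply: (lipschitz_sub_measurable sigG mY (L := 1)) => w w'.
by rewrite mul1r lerBlDl; exact: dist_to_lipschitz.
Qed.

Lemma measurable_enorm : measurable_fun setT (fun w => E_enorm (c w)).
Proof.
have sT : sigma_algebra setT (@measurable _ T).
  by split; [exact: measurable0|by move=> A mA; rewrite setTD; exact: measurableC|exact: bigcupT_measurable].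
have mc' : E_measurable_wrt measurable c by move=> i B mB; rewrite -[X in measurable X]setTI; apply: mc.
move=> _ B mB; rewrite setTI; apply: (lipschitz_sub_measurable sT mc' (L := 1)) mB => w w'.
by rewrite mul1r lerBlDl; have := enorm_triangle (c w') (c w - c w'); rewrite addrC subrK.
Qed.

Let mexp : measurable_fun setT (fun w => expR (lam * E_enorm (c w))).
Proof.
apply: measurableT_comp; first exact: measurable_expR.
by apply: measurable_funM => //; exact: measurable_enorm.
Qed.

Let iexp : P.-integrable setT (EFin \o (fun w => expR (lam * E_enorm (c w)))).
Proof.
apply/integrableP; split; first exact/measurable_EFinP.
under eq_integral do rewrite /= ger0_norm ?expR_ge0//.
apply: le_lt_trans (cM (sub_setT sigG)) _.
by rewrite probability_setT mule1 ltry.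
Qed.

Let idot (u : T -> 'rV[R]_d) (b : 'rV[R]_d) A : measurable A ->
  (forall i, P.-integrable setT (fun w => (u w ord0 i)%:E)) ->
  P.-integrable A (EFin \o (fun w => E_dotv (u w) b)).
Proof.
move=> mA iu.
have -> : EFin \o (fun w => E_dotv (u w) b) =
    (fun w => \sum_(i < d) ((b ord0 i)%:E * (u w ord0 i)%:E)%E)%R.
  apply/funext => w; rewrite /= /E_dotv -sumEFin.
  by apply: eq_bigr => i _; rewrite mulrC EFinM.
apply: integrable_sum => // i _; apply: integrableZl => //.
exact: (integrableS measurableT).
Qed.

(** For a constant direction [b], linearity reduces the claim to the coordinatewise conditional
    expectations. *)
Lemma Rintegral_dot A (b : 'rV[R]_d) : G A ->
  \int[P]_(w in A) (E_dotv (c w) b) = \int[P]_(w in A) (E_dotv (g w) b).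
Proof.
move=> GA; have mA := mG GA.
have E (u : T -> 'rV[R]_d) : (forall i, P.-integrable setT (fun w => (u w ord0 i)%:E)) ->
  (\int[P]_(w in A) (E_dotv (u w) b)%:E =
   \sum_(i < d) ((b ord0 i)%:E * \int[P]_(w in A) (u w ord0 i)%:E)%E)%E.
  move=> iu; have iuA i := integrableS measurableT mA (@subsetT _ _) (iu i).
  transitivity (\int[P]_(w in A) \sum_(i < d) ((b ord0 i)%:E * (u w ord0 i)%:E)%E)%E.
    apply: eq_integral => w _; rewrite /E_dotv -sumEFin.
    by apply: eq_bigr => i _; rewrite mulrC EFinM.
  rewrite integral_sum//; last by move=> i; apply: integrableZl.
  by apply: eq_bigr => i _; rewrite integralZl.
rewrite /Rintegral !E; first last.
  by move=> i; have [] := cg.2 i.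
  by move=> i; have [_ []] := cg.2 i.
congr fine; apply: eq_bigr => i _; congr (_ * _)%E.
by have [_ [_]] := cg.2 i; apply.
Qed.

(** The contraction bound with its discretisation errors: both the prefactor and the integrable
    extra term become harmless as [eps] tends to 0. *)
Let rhs eps w := expR (4 * th * eps) *
  ((1 - h * kappa / 2) * expR (th * dist w) +
   eps * (4 * th / r * expR (th * Dmax)) * (kappa + l1 w)).

Let h_gt0 : 0 < h. Proof. exact: mulr_gt0. Qed.

Let rate_ge0 : 0 <= 1 - h * kappa / 2.
Proof.
have := hkappa; rewrite -(ler_pM2r kappa0) mulVf ?gt_eqF//; lra.
Qed.

Let l1_ge0 w : 0 <= l1 w. Proof. exact: sumr_ge0. Qed.

Let mdist : measurable_fun setT dist.
Proof. exact: (sub_measurable_fun sub_measurable_dist). Qed.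

Let mexpdist : measurable_fun setT (fun w => expR (th * dist w)).
Proof.
apply: measurableT_comp; first exact: measurable_expR.
by apply: measurable_funM => //; exact: mdist.
Qed.

Let iexpdist : P.-integrable setT (EFin \o (fun w => expR (th * dist w))).
Proof.
apply: measurable_bounded_integrable => //.
  by apply: le_lt_trans (probability_le1 _ _) _ => //; rewrite ltry.
exists (expR (th * Dmax)); split; first exact: num_real.
move=> x xD w _ /=; rewrite ger0_norm ?expR_ge0//.
by apply: le_trans (ltW xD); rewrite ler_expR ler_pM2l//; exact: Ymax.
Qed.

Let il1 : P.-integrable setT (EFin \o l1).
Proof.
have -> : EFin \o l1 = (fun w => \sum_(i < d) (`|g w ord0 i|%:E))%R.
  by apply/funext => w; rewrite /= sumEFin.
apply: integrable_sum => // i _; apply: (@integrable_norm _ _ _ _ _ (fun w => g w ord0 i)).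
by have [_ []] := cg.2 i.
Qed.

Let icst (k : R) : P.-integrable setT (EFin \o (fun=> k)).
Proof. exact: finite_measure_integrable_cst. Qed.

Let iZ (a : R) (f : T -> R) A : measurable A -> P.-integrable A (EFin \o f) ->
  P.-integrable A (EFin \o (fun w => a * f w)).
Proof. by move=> mA fi; exact: (@integrableZl _ _ _ _ _ mA a _ fi). Qed.

Let iD (f1 f2 : T -> R) A : measurable A -> P.-integrable A (EFin \o f1) ->
  P.-integrable A (EFin \o f2) -> P.-integrable A (EFin \o (fun w => f1 w + f2 w)).
Proof. by move=> mA i1 i2; exact: (@integrableD _ _ _ _ _ mA _ _ i1 i2). Qed.

Let irhs eps : P.-integrable setT (EFin \o rhs eps).
Proof.
apply: iZ => //; apply: (@iD (fun w => _ * _) (fun w => _ * (_ + _))) => //; apply: iZ => //.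
exact: (@iD (fun=> kappa)).
Qed.

Let le_Rint_integral (f1 f2 : T -> R) A : measurable A ->
  P.-integrable A (EFin \o f1) -> P.-integrable A (EFin \o f2) ->
  \int[P]_(w in A) f1 w <= \int[P]_(w in A) f2 w ->
  (\int[P]_(w in A) (f1 w)%:E <= \int[P]_(w in A) (f2 w)%:E)%E.
Proof.
move=> mA i1 i2; rewrite /Rintegral -lee_fin !fineK//; exact: integrable_fin_num.
Qed.

(* On a cell where x_t is near [s] and some nearest point of [S] is near [q], the direction
   x_t - p may be replaced by the constant s - q: this needs no measurable selection of p,
   and the conditional expectations only get integrated over sets of [G]. *)
Lemma one_step_cell A eps (s q : 'rV[R]_d) : G A -> 0 < eps -> eps <= r * al / 4 ->
  (forall w, A w -> r * al <= dist w) ->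
  (forall w, A w -> E_enorm (Y w - s) <= eps) ->
  (forall w, A w -> exists p, [/\ S p, E_enorm (Y w - p) = dist w & E_enorm (q - p) <= eps]) ->
  (\int[P]_(w in A) (expR (th * D' w))%:E <= \int[P]_(w in A) (rhs eps w)%:E)%E.
Proof.
move=> GA eps0 eps_le Ar As Aq; have mA := mG GA.
have [->|/set0P[w0 Aw0]] := eqVneq A set0; first by rewrite !integral_set0.
pose v := s - q.
have vY w p : A w -> E_enorm (q - p) <= eps -> E_enorm (v - (Y w - p)) <= 2 * eps.
  move=> Aw qp.
  have -> : v - (Y w - p) = (s - Y w) + - (q - p) by rewrite /v; apply/rowP => i; rewrite !mxE; ring.
  apply: le_trans (enorm_triangle _ _) _; rewrite enormN enormB.
  have := As w Aw; lra.
have vdist w : A w -> `|E_enorm v - dist w| <= 2 * eps.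
  move=> Aw; have [p [Sp Yp qp]] := Aq w Aw; have := vY w p Aw qp.
  have := enorm_triangle (v - (Y w - p)) (Y w - p); rewrite subrK Yp.
  have := enorm_triangle (Y w - p - v) v; rewrite subrK Yp (enormB _ v).
  by rewrite ler_norml; lra.
(* The cell lies in the far region and [2 * eps <= r * al / 2]. *)
have vr : r * al / 2 <= E_enorm v.
  by have := vdist _ Aw0; have := Ar _ Aw0; rewrite ler_norml; lra.
have ral : 0 < r * al by rewrite mulr_gt0.
have v0 : 0 < E_enorm v by apply: lt_le_trans vr; rewrite divr_gt0.
pose b := (E_enorm v)^-1 *: v.
pose be := expR (2 * th * eps) * expR (th * E_enorm v).
have be0 : 0 <= be by rewrite mulr_ge0 ?expR_ge0.
(* [phi1] bounds the integrand pointwise; [phi2] is [phi1] with [c] replaced by its conditional mean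
   and the exponential by its bound [M]. Passing from [phi1] to [phi2] is the only non-pointwise
   step. *)
pose phi1 w := be * (1 + (- h * E_dotv (c w) b + h * k0 * expR (lam * E_enorm (c w)))).
pose phi2 w := be * (1 + (- h * E_dotv (g w) b + h * k0 * M)).
have ic := idot b mA (fun i => (cg.2 i).1).
have ig := idot b mA (fun i => (cg.2 i).2.1).
have ie := integrableS measurableT mA (@subsetT _ _) iexp.
have i1 (k : R) := integrableS measurableT mA (@subsetT _ _) (icst k).
have iphi1 : P.-integrable A (EFin \o phi1).
  apply: iZ => //; apply: (@iD (fun=> 1)) => //.
  by apply: (@iD (fun w => _ * _) (fun w => _ * _)) => //; exact: iZ.
have iphi2 : P.-integrable A (EFin \o phi2).
  apply: iZ => //; apply: (@iD (fun=> 1)) => //.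
  by apply: (@iD (fun w => _ * _) (fun=> _)) => //; exact: iZ.
have le1 w : A w -> expR (th * D' w) <= phi1 w.
  move=> Aw; have [p [Sp Yp qp]] := Aq w Aw.
  apply: (@le_trans _ _ (expR (2 * th * eps) * expR (th * E_enorm (v - al *: c w)))).
    rewrite -expRD ler_expR.
    have -> : 2 * th * eps + th * E_enorm (v - al *: c w) = th * (E_enorm (v - al *: c w) + 2 * eps) by ring.
    rewrite ler_pM2l//; apply: le_trans (D'le w Sp) _.
    have -> : Y w - al *: c w - p = (v - al *: c w) + - (v - (Y w - p)).
      by apply/rowP => i; rewrite !mxE; ring.
    by apply: le_trans (enorm_triangle _ _) _; rewrite enormN; have := vY w p Aw qp; lra.
  rewrite /phi1 /be -(mulrA (expR _)) ler_pM2l ?expR_gt0//.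
  apply: le_trans (expR_step (c w) al0 th0 r0 lam0 hlam vr) _.
  by rewrite ler_pM2l ?expR_gt0// -/b -/h -/k0; lra.
have le2 w : A w -> phi2 w <= rhs eps w.
  move=> Aw; have [p [Sp Yp qp]] := Aq w Aw.
  have dv := vdist w Aw; move: dv; rewrite ler_norml => dv.
  (* The drift condition is transferred from the true direction [Y w - p] to [v], which differs from
     it by at most [2 * eps]. *)
  have gv : kappa * E_enorm v - 2 * eps * (kappa + l1 w) <= E_dotv (g w) v.
    have := drift Sp Yp; rewrite Yp => dr.
    have : E_dotv (g w) v = E_dotv (g w) (Y w - p) + E_dotv (g w) (v - (Y w - p)).
      by rewrite -dotDr addrC subrK.
    have := dot_le_l1 (g w) (v - (Y w - p)); rewrite ler_norml -/(l1 w).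
    have : l1 w * E_enorm (v - (Y w - p)) <= l1 w * (2 * eps).
      by rewrite ler_wpM2l// vY.
    have : kappa * E_enorm v <= kappa * (dist w + 2 * eps) by rewrite ler_pM2l//; lra.
    lra.
  have gb : kappa - 4 * eps * (kappa + l1 w) / (r * al) <= E_dotv (g w) b.
    rewrite /b dotZr [leRHS]mulrC ler_pdivlMr//.
    apply: le_trans gv.
    have : 4 * eps * (kappa + l1 w) / (r * al) * (r * al / 2) <= 4 * eps * (kappa + l1 w) / (r * al) * E_enorm v.
      rewrite ler_wpM2l// divr_ge0 ?(ltW ral)//.
      by rewrite !mulr_ge0 ?ltW// ltr_wpDr.
    have -> : 4 * eps * (kappa + l1 w) / (r * al) * (r * al / 2) = 2 * eps * (kappa + l1 w).
      by field; rewrite !gt_eqF.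
    lra.
  have X : 1 + (- h * E_dotv (g w) b + h * k0 * M) <=
      1 - h * kappa / 2 + eps * (4 * th / r) * (kappa + l1 w).
    have : h * (k0 * M) <= h * (kappa / 2) by rewrite ler_pM2l.
    have : h * (kappa - 4 * eps * (kappa + l1 w) / (r * al)) <= h * E_dotv (g w) b by rewrite ler_pM2l.
    have -> : h * (kappa - 4 * eps * (kappa + l1 w) / (r * al)) = h * kappa - eps * (4 * th / r) * (kappa + l1 w).
      by rewrite /h; field; rewrite !gt_eqF.
    lra.
  apply: (@le_trans _ _ (be * (1 - h * kappa / 2 + eps * (4 * th / r) * (kappa + l1 w)))).
    by rewrite ler_wpM2l.
  have W0 : 0 <= eps * (4 * th / r) * (kappa + l1 w).
    apply: mulr_ge0; last by apply: addr_ge0; [exact: ltW|exact: l1_ge0].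
    by rewrite ltW// !mulr_gt0 ?invr_gt0.
  apply: (@le_trans _ _ (expR (4 * th * eps) * expR (th * dist w) *
    (1 - h * kappa / 2 + eps * (4 * th / r) * (kappa + l1 w)))).
    apply: ler_wpM2r; first exact: addr_ge0.
    rewrite /be -!expRD ler_expR.
    have : th * E_enorm v <= th * (dist w + 2 * eps) by rewrite ler_pM2l//; lra.
    lra.
  rewrite -(mulrA (expR _)) ler_pM2l ?expR_gt0// mulrDr (mulrC (expR _)) lerD2l.
  have -> : eps * (4 * th / r * expR (th * Dmax)) * (kappa + l1 w) =
    expR (th * Dmax) * (eps * (4 * th / r) * (kappa + l1 w)) by ring.
  by rewrite ler_wpM2r// ler_expR ler_pM2l//; exact: Ymax.
apply: (@le_trans _ _ (\int[P]_(w in A) (phi1 w)%:E)%E).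
  apply: ge0_le_integral => //.
  - apply/measurable_EFinP/measurable_funTS; apply: measurableT_comp; first exact: measurable_expR.
    exact: measurable_funM.
  - by case/integrableP: iphi1.
apply: (@le_trans _ _ (\int[P]_(w in A) (phi2 w)%:E)%E); last first.
  apply: le_integral => //; first exact: (integrableS measurableT mA (@subsetT _ _) (irhs eps)).
  by move=> w; rewrite inE lee_fin; exact: le2.
apply: le_Rint_integral => //.
rewrite /phi1 /phi2 !RintegralZl//; last 2 first.
- by apply: (@iD (fun=> 1)) => //; apply: (@iD (fun w => _ * _) (fun=> _)) => //; exact: iZ.
- by apply: (@iD (fun=> 1)) => //; apply: (@iD (fun w => _ * _) (fun w => _ * _)) => //; exact: iZ.
apply: ler_wpM2l => //.
have icM : P.-integrable A (EFin \o (fun w => h * k0 * expR (lam * E_enorm (c w)))) by exact: iZ.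
have ich : P.-integrable A (EFin \o (fun w => - h * E_dotv (c w) b)) by exact: iZ.
have igh : P.-integrable A (EFin \o (fun w => - h * E_dotv (g w) b)) by exact: iZ.
rewrite (@RintegralD _ _ _ _ _ (fun=> 1))//; last exact: iD.
rewrite (@RintegralD _ _ _ _ _ (fun=> 1))//; last exact: iD.
rewrite !RintegralD// lerD2l !RintegralZl// Rintegral_dot// lerD2l Rintegral_cst//.
have k00 : 0 <= k0 by rewrite mulr_ge0 ?addr_ge0 ?invr_ge0 ?divr_ge0 ?exprn_ge0 ?ltW.
apply: ler_wpM2l; first by apply: mulr_ge0 => //; exact: ltW.
have := cM GA.
by rewrite -(fineK (integrable_fin_num mA ie)) -(fineK (fin_num_measure P A mA)) -EFinM lee_fin.
Qed.

Let N := [set w | r * al <= dist w].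

Let GN : G N.
Proof.
have -> : N = dist @^-1` `[r * al, +oo[.
  by apply/seteqP; split=> w; rewrite /N /= in_itv /= andbT.
exact: sub_measurable_dist.
Qed.

Let mexpD' : measurable_fun setT (fun w => expR (th * D' w)).
Proof. by apply: measurableT_comp; [exact: measurable_expR|exact: measurable_funM]. Qed.

(** A cell fixes a box containing x_t and a grid point near which some nearest minimizer lies; there
    are countably many such cells and they all belong to [G]. *)
Lemma one_step_approx eps : 0 < eps -> eps <= r * al / 4 ->
  (\int[P]_(w in N) (expR (th * D' w))%:E <= \int[P]_(w in N) (rhs eps w)%:E)%E.
Proof.
move=> eps0 epsr.
pose e := eps / d.+1%:R.
have e0 : 0 < e by rewrite divr_gt0.
have de : d%:R * e <= eps.
  rewrite /e mulrA ler_pdivrMr// mulrC ler_pM2l// ler_nat leqnSn//.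
pose K (q : 'rV[int]_d) := S `&` [set z | E_enorm (grid e q - z) <= d%:R * e].
have cK q : compact (K q) by apply: compact_closedI => //; exact: closed_enorm_ball.
(* That a nearest point of [S] lies in [K q] is expressed by equality of two distances, both
   Lipschitz in [Y], hence by an event of [G]. An empty [K q] is excluded, since its distance is 0
   by convention. *)
pose C k := if @unpickle ('rV[int]_d * 'rV[int]_d)%type k is Some (s, q) then
  (Y @^-1` grid_box e s) `&`
  (if K q == set0 then set0 else [set w | E_dist_to (K q) (Y w) = dist w]) else set0.
have GC k : G (C k).
  rewrite /C; case: unpickle => [[s q]|]; last exact: (sub_set0 sigG).
  apply: (sub_setI sigG); first exact: sub_grid_box.
  case: ifP => _; first exact: (sub_set0 sigG).
  have -> : [set w | E_dist_to (K q) (Y w) = dist w] =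
      (fun w => E_dist_to (K q) (Y w) - dist w) @^-1` [set 0].
    apply/seteqP; split=> w /= H; first by rewrite H subrr.
    by apply/eqP; rewrite -subr_eq0 H.
  apply: (sub_measurableB sigG) => //; last exact: sub_measurable_dist.
  apply: (lipschitz_sub_measurable sigG mY (L := 1)) => w w'.
  by rewrite mul1r lerBlDl; exact: dist_to_lipschitz.
have mrhs : measurable_fun setT (rhs eps).
  by apply/measurable_EFinP; case/integrableP: (irhs eps).
have rhs0 w : 0 <= rhs eps w.
  apply: mulr_ge0; first exact: expR_ge0.
  apply: addr_ge0; first by apply: mulr_ge0 => //; exact: expR_ge0.
  apply: mulr_ge0; last by apply: addr_ge0; [exact: ltW|exact: l1_ge0].
  by rewrite ltW// !mulr_gt0 ?invr_gt0 ?expR_gt0.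
apply: (@le_integral_cover _ (rhs eps) C) => //.
- move=> w _.
  have [s ws] := grid_box_cover (Y w) e0.
  have [p Sp Yp] := dist_to_attained (Y w) S0 cS.
  have [q pq] := grid_box_cover p e0.
  have Kp : K q p by split=> //=; rewrite enormB; exact: grid_box_center.
  exists (pickle (s, q)) => //; rewrite /C pickleK; split=> //.
  case: ifP => [/eqP Kq0|_ /=]; first by rewrite Kq0 in Kp.
  apply/eqP; rewrite eq_le /dist -Yp dist_to_le//= Yp.
  apply: lb_le_inf; first by exists (E_enorm (Y w - p)); exists p.
  by move=> _ [z [Sz _] <-]; exact: dist_to_le.
- move=> k A GA AC AN.
  have [->|/set0P[w0 Aw0]] := eqVneq A set0; first by rewrite !integral_set0.
  move: AC; rewrite /C; case: unpickle => [[s q]|AC]; last by have := AC _ Aw0.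
  case: ifP => [_ AC|/negbT/set0P Kq AC]; first by have [] := AC _ Aw0.
  apply: (@one_step_cell A eps (grid e s) (grid e q)) => //.
  + by move=> w /AC[/= ws _]; apply: le_trans de; exact: grid_box_center.
  + move=> w /AC[/= _ wd]; have [p [Sp pq] Yp] := dist_to_attained (Y w) Kq (cK q).
    by exists p; split; rewrite ?Yp//; apply: le_trans de.
Qed.

(** Let [eps] tend to 0 in [one_step_approx]; the limit is taken by contradiction, with an explicit
    [eps]. *)
Lemma one_step_far :
  (\int[P]_(w in N) (expR (th * D' w))%:E <=
   (1 - h * kappa / 2)%:E * \int[P]_(w in N) (expR (th * dist w))%:E)%E.
Proof.
have mN := mG GN.
have iN (f : T -> R) : P.-integrable setT (EFin \o f) -> P.-integrable N (EFin \o f).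
  exact: integrableS.
pose I := \int[P]_(w in N) expR (th * dist w).
pose Q := 4 * th / r * expR (th * Dmax) * \int[P]_(w in N) (kappa + l1 w).
have il : P.-integrable setT (EFin \o (fun w => kappa + l1 w)) by exact: (@iD (fun=> kappa)).
have IE eps : (\int[P]_(w in N) (rhs eps w)%:E =
    (expR (4 * th * eps) * ((1 - h * kappa / 2) * I + eps * Q))%:E)%E.
  have -> : (\int[P]_(w in N) (rhs eps w)%:E = (\int[P]_(w in N) rhs eps w)%:E)%E.
    by rewrite /Rintegral fineK//; exact: (integrable_fin_num mN (iN _ (irhs eps))).
  congr EFin; rewrite /rhs RintegralZl//; last first.
    by apply: iN; apply: (@iD (fun w => _ * _) (fun w => _ * (_ + _))) => //; exact: iZ.
  congr (_ * _); rewrite RintegralD//; [|by apply: iN; exact: iZ..].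
  rewrite !RintegralZl//; [|exact: iN..].
  by rewrite /I /Q; ring.
have QF : 0 <= Q.
  apply: mulr_ge0; first by rewrite ltW// !mulr_gt0 ?invr_gt0 ?expR_gt0.
  apply: Rintegral_ge0 => // w _; apply: addr_ge0; [exact: ltW|exact: l1_ge0].
have ral : 0 < r * al / 4 by rewrite divr_gt0// mulr_gt0.
have F0 : (0 <= \int[P]_(w in N) (expR (th * D' w))%:E)%E.
  by apply: integral_ge0 => w _; rewrite lee_fin expR_ge0.
have FI eps : 0 < eps -> eps <= r * al / 4 ->
    (\int[P]_(w in N) (expR (th * D' w))%:E <=
     (expR (4 * th * eps) * ((1 - h * kappa / 2) * I + eps * Q))%:E)%E.
  by move=> e0 e1; rewrite -IE; exact: one_step_approx.
have -> : (\int[P]_(w in N) (expR (th * dist w))%:E = I%:E)%E.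
  by rewrite /I /Rintegral fineK//; exact: (integrable_fin_num mN (iN _ iexpdist)).
rewrite -EFinM.
have Ffin : (\int[P]_(w in N) (expR (th * D' w))%:E)%E \is a fin_num.
  by rewrite ge0_fin_numE//; apply: le_lt_trans (FI _ ral (lexx _)) _; rewrite ltry.
move: F0 FI Ffin; case: (\int[P]_(w in N) _)%E => // f; rewrite lee_fin => f0 FI _.
rewrite lee_fin leNgt; apply/negP => lt_f.
set rI := (1 - h * kappa / 2) * I in FI lt_f.
set W := Q + 4 * th * f.
have W0 : 0 <= W by apply: addr_ge0 => //; apply: mulr_ge0 => //; rewrite ltW// mulr_gt0.
(* Move the prefactor to the left and use [exp (- s) >= 1 - s]: the excess [f - rI] is then at most
   linear in [eps]. *)
have H eps : 0 < eps -> eps <= r * al / 4 -> f - rI <= eps * W.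
  move=> e0 e1; have := FI _ e0 e1; rewrite lee_fin => fle.
  have E1 : expR (- (4 * th * eps)) * f <= rI + eps * Q.
    by rewrite expRN ler_pdivrMl ?expR_gt0.
  have : (1 - 4 * th * eps) * f <= expR (- (4 * th * eps)) * f.
    by apply: ler_wpM2r => //; apply: expR_ge1Dx.
  by rewrite /W; lra.
(* With this choice [eps * W] is at most half of the excess [f - rI], which contradicts [H]. *)
pose eps := Num.min (r * al / 4) ((f - rI) / (2 * (W + 1))).
have W1 : 0 < 2 * (W + 1) by rewrite mulr_gt0// ltr_wpDl.
have eps0 : 0 < eps by rewrite lt_min ral divr_gt0 ?subr_gt0.
have eps1 : eps <= r * al / 4 by rewrite ge_min lexx.
have : eps * W <= (f - rI) / (2 * (W + 1)) * W by rewrite ler_wpM2r// ge_min lexx orbT.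
have : (f - rI) / (2 * (W + 1)) * W <= (f - rI) / 2.
  rewrite mulrAC ler_pdivrMr//.
  have -> : (f - rI) / 2 * (2 * (W + 1)) = (f - rI) * (W + 1) by field.
  by rewrite ler_pM2l ?subr_gt0// lerDl.
have := H _ eps0 eps1; lra.
Qed.

Let M_ge0 : 0 <= M.
Proof.
have := cM (sub_setT sigG); rewrite probability_setT mule1 => H.
rewrite -lee_fin; apply: le_trans H; apply: integral_ge0 => w _.
by rewrite lee_fin expR_ge0.
Qed.

(** On the far region the contraction applies. On its complement the distance is below [r * al], so
    the triangle inequality bounds the exponential by [exp (h * r)] times [exp (lam * |c|)], of mean
    at most [M]. *)
Lemma one_step :
  (\int[P]_w (expR (th * D' w))%:E <=
   (1 - h * kappa / 2)%:E * \int[P]_w (expR (th * dist w))%:E + (expR (h * r) * M)%:E)%E.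
Proof.
have mN := mG GN; have mCN := measurableC mN.
have near : (\int[P]_(w in ~` N) (expR (th * D' w))%:E <= (expR (h * r) * M)%:E)%E.
  apply: (@le_trans _ _ (\int[P]_(w in ~` N) ((expR (h * r))%:E * (expR (lam * E_enorm (c w)))%:E))%E).
    apply: ge0_le_integral => //.
    - exact/measurable_EFinP/measurable_funTS.
    - apply: measurable_funeM; exact/measurable_EFinP/measurable_funTS.
    - move=> w /= /negP; rewrite -ltNge => wN; rewrite -EFinM lee_fin -expRD ler_expR.
      have [p Sp Yp] := dist_to_attained (Y w) S0 cS.
      have EaC : E_enorm (al *: c w) = al * E_enorm (c w).
        by rewrite /E_enorm dotZl dotZr mulrA -expr2 sqrtrM ?sqr_ge0// sqrtr_sqr gtr0_norm.
      have D1 : D' w <= dist w + al * E_enorm (c w).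
        apply: le_trans (D'le w Sp) _; rewrite -EaC /dist -Yp.
        by rewrite addrAC; apply: le_trans (enorm_triangle _ _) _; rewrite enormN.
      have : th * D' w <= th * (r * al + al * E_enorm (c w)) by rewrite ler_pM2l//; lra.
      have : h * E_enorm (c w) <= lam * E_enorm (c w).
        by apply: ler_wpM2r; [exact: enorm_ge0|apply: (le_trans hlam); have := lam0; lra].
      rewrite /h; lra.
  rewrite integralZl//; last exact: (integrableS measurableT mCN (@subsetT _ _) iexp).
  rewrite EFinM; apply: lee_wpmul2l; first by rewrite lee_fin expR_ge0.
  apply: le_trans (cM (sub_setC sigG GN)) _.
  rewrite -[leRHS]mule1; apply: lee_wpmul2l; first by rewrite lee_fin.
  exact: probability_le1.
have -> : (\int[P]_w (expR (th * D' w))%:E = \int[P]_(w in N) (expR (th * D' w))%:E +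
    \int[P]_(w in ~` N) (expR (th * D' w))%:E)%E.
  rewrite -ge0_integral_setU ?setUv//; last by rewrite disj_set2E setICr.
  exact/measurable_EFinP.
apply: leeD => //; apply: le_trans one_step_far _.
apply: lee_wpmul2l; first by rewrite lee_fin.
apply: ge0_subset_integral => //; exact/measurable_EFinP.
Qed.

End one_step.

(** * Iterating the recursion *)

Section deterministic_bounds.
Variable R : realType.

(** The quotient telescopes into factors [1 + 1 / (v + i)], each at most an exponential: a lower
    bound on harmonic sums without logarithms. *)
Lemma harmonic_expR (v : R) m : 0 < v -> (v + m%:R) / v <= expR (\sum_(i < m) (v + i%:R)^-1).
Proof.
move=> v0; elim: m => [|m IH]; first by rewrite big_ord0 expR0 addr0 divff ?gt_eqF.
rewrite big_ord_recr /= expRD.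
have vm : 0 < v + m%:R by rewrite ltr_pwDl.
have -> : (v + m.+1%:R) / v = (v + m%:R) / v * (1 + (v + m%:R)^-1).
  by rewrite -natr1; field; rewrite !gt_eqF.
apply: ler_pM => //; last exact: expR_ge1Dx.
- by rewrite divr_ge0// ltW.
- by rewrite addr_ge0// invr_ge0 ltW.
Qed.

Lemma powR_le_mul (gam C x y : R) : 0 <= gam <= 1 -> 1 <= C -> 0 <= x -> 0 <= y ->
  x <= C * y -> x `^ gam <= C * y `^ gam.
Proof.
move=> /andP[g0 g1] C1 x0 y0 xy.
have C0 : 0 <= C by apply: le_trans C1.
apply: (@le_trans _ _ ((C * y) `^ gam)).
  by apply: ge0_ler_powR; rewrite ?nnegrE ?mulr_ge0.
rewrite powRM//; apply: ler_wpM2r; first exact: powR_ge0.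
by rewrite -[leRHS]powRr1//; apply: ler_powR.
Qed.

Lemma powR_le_add1 (gam x : R) : 0 <= gam <= 1 -> 0 <= x -> x `^ gam <= x + 1.
Proof.
move=> gam01 x0; have x1 : 1 <= x + 1 by rewrite lerDr.
by have := powR_le_mul gam01 x1 x0 ler01; rewrite mulr1 powR1 mulr1; apply; rewrite lerDl.
Qed.

(** The level [B / mu0] is preserved because [mu i >= mu0], and the excess over it contracts by
    [1 - mu i <= exp (- mu i)]. The exact sum of the [mu i] is kept, since it must later compensate
    [Z0]. *)
Lemma affine_recursion (Z : nat -> \bar R) (mu : nat -> R) (mu0 B Z0 : R) m :
  0 < mu0 -> 0 <= B -> 0 <= Z0 -> (Z 0%N <= Z0%:E)%E ->
  (forall i, (i < m)%N -> mu0 <= mu i <= 1) ->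
  (forall i, (i < m)%N -> (Z i.+1 <= (1 - mu i)%:E * Z i + B%:E)%E) ->
  (Z m <= (expR (- \sum_(i < m) mu i) * Z0 + B / mu0)%:E)%E.
Proof.
move=> mu00 B0 Z00 HZ; elim: m => [|m IH] Hmu Hrec.
  rewrite big_ord0 oppr0 expR0 mul1r; apply: le_trans HZ _.
  by rewrite lee_fin lerDl divr_ge0// ltW.
have /andP[mu1 mu2] := Hmu m (leqnn _).
have Bm : 0 <= B / mu0 by rewrite divr_ge0// ltW.
apply: le_trans (Hrec m (leqnn _)) _.
apply: (@le_trans _ _ ((1 - mu m)%:E * (expR (- \sum_(i < m) mu i) * Z0 + B / mu0)%:E + B%:E)%E).
  apply: leeD => //; apply: lee_wpmul2l; first by rewrite lee_fin subr_ge0.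
  by apply: IH => i im; [apply: Hmu|apply: Hrec]; exact: ltnW.
rewrite -EFinM -EFinD lee_fin big_ord_recr /= opprD expRD.
set E := expR (- \sum_(i < m) _).
have E0 : 0 <= E * Z0 by rewrite mulr_ge0 ?expR_ge0.
have : (1 - mu m) * (E * Z0) <= expR (- mu m) * (E * Z0).
  by apply: ler_wpM2r => //; exact: expR_ge1Dx.
have : mu0 * (B / mu0) <= mu m * (B / mu0) by apply: ler_wpM2r.
rewrite [mu0 * _]mulrC divfK ?gt_eqF//; lra.
Qed.

End deterministic_bounds.

(** * The set of minimizers of a Lipschitz function on a compact set *)

Section argmin.
Variables (R : realType) (d : nat) (X : set 'rV[R]_d) (l : 'rV[R]_d -> R) (C : R).
Hypotheses (X0 : X !=set0) (clX : closed X) (bX : E_boundedR X).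
Hypothesis lC : forall x y, X x -> X y -> `|l x - l y| <= C * E_enorm (x - y).

Let lipschitz_near (x : 'rV[R]_d) e : 0 < e ->
  \forall y \near x, C * E_enorm (x - y) < e.
Proof.
move=> e0; have C1 : 0 < `|C| + 1 by rewrite ltr_wpDl.
have d0 : 0 < e / (`|C| + 1) by rewrite divr_gt0.
have : E_enorm (x - y) @[y --> x] --> (0 : R).
  by have := @enorm_continuous R d x x; rewrite /continuous_at subrr enorm0.
move=> /cvgrPdist_lt/(_ _ d0); apply: filterS => y.
rewrite sub0r normrN ger0_norm ?enorm_ge0// ltr_pdivlMr// mulrC; apply: le_lt_trans.
apply: ler_wpM2r; first exact: enorm_ge0.
by apply: le_trans (ler_norm _) _; rewrite lerDl.
Qed.

Lemma argmin_nonempty : E_argmin_set X l !=set0.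
Proof.
have [||p Xp pmin] := @EVT_min_rV R d l X X0.
- exact: boundedR_closed_compact.
- apply/subspace_continuousP => x Xx; apply/cvgrPdist_lt => e e0.
  rewrite near_withinE; near=> y => Xy.
  apply: le_lt_trans (lC Xx Xy) _; near: y; exact: lipschitz_near.
exists p; split; first by rewrite inE in Xp.
by move=> z Xz; apply: pmin; rewrite inE.
Unshelve. all: by end_near. Qed.

(** A limit of minimizers first lies in [X], which is closed; only then does the Lipschitz bound
    apply and give minimality up to every [e]. *)
Lemma argmin_compact : compact (E_argmin_set X l).
Proof.
apply: (subclosed_compact _ (boundedR_closed_compact clX bX)); last by move=> x [].
move=> x clx.
have Xx : X x by apply: clX => B /clx[y [[Xy _] By]]; exists y.
split=> // z Xz; apply/ler_addgt0Pr => e e0.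
have [y [[Xy ymin] yx]] := clx _ (lipschitz_near x e0).
apply: le_trans (_ : l y + e <= _); last by rewrite lerD2r ymin.
rewrite -lerBlDl; apply: le_trans (ler_norm _) _.
exact: le_trans (lC Xx Xy) (ltW yx).
Qed.

Lemma min_val_ge0 x : X x -> 0 <= l x - E_min_val X l.
Proof.
move=> Xx; rewrite subr_ge0; apply: ge_inf; last by exists x.
by have [p [_ pmin]] := argmin_nonempty; exists (l p) => _ [z Xz <-]; exact: pmin.
Qed.

Lemma min_val_le x : X x -> l x - E_min_val X l <= `|C| * E_dist_to (E_argmin_set X l) x.
Proof.
move=> Xx; have [p [Xp pmin] <-] := dist_to_attained x argmin_nonempty argmin_compact.
have : l p <= E_min_val X l.
  by apply: lb_le_inf; [exists (l p); exists p|move=> _ [z Xz <-]; exact: pmin].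
have := le_trans (ler_norm _) (lC Xx Xp).
have : C * E_enorm (x - p) <= `|C| * E_enorm (x - p).
  by apply: ler_wpM2r; [exact: enorm_ge0|exact: ler_norm].
lra.
Qed.

End argmin.

(** * Uniform exponential moments along the iterates *)

Section psgd.
Variables (R : realType) (d : nat)
  (X : set 'rV[R]_d) (l : 'rV[R]_d -> R) (gradl : 'rV[R]_d -> 'rV[R]_d)
  (dT : measure_display) (Omega : measurableType dT) (P : probability Omega R)
  (F : nat -> set (set Omega))
  (x c : nat -> Omega -> 'rV[R]_d)
  (a u gamma kappa lambda M : R).
Hypotheses (X0 : X !=set0) (clX : closed X) (bX : E_boundedR X) (cX : E_convexR X)
  (lipl : E_lipschitz_on X l)
  (a0 : 0 < a) (u0 : 0 < u) (gamma01 : 0 <= gamma <= 1)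
  (FF : E_filtration F)
  (Xx0 : forall w, X (x 0%N w)) (mx0 : E_measurable_wrt (F 0%N) (x 0%N))
  (mc : forall t, E_measurable_wrt (F t.+1) (c t))
  (cg : forall t, E_cond_exp_eq P (F t) (c t) (fun w => gradl (x t w)))
  (step : forall t w, E_is_proj X (x t w - (a / powR (u + t%:R) gamma) *: c t w)
                         (x t.+1 w))
  (kappa0 : 0 < kappa)
  (D1 : forall y ys, X y -> E_argmin_set X l ys ->
     E_enorm (y - ys) = E_dist_to (E_argmin_set X l) y ->
     kappa * E_enorm (y - ys) <= E_dotv (gradl y) (y - ys))
  (lambda0 : 0 < lambda)
  (D2 : forall t, E_cond_exp_le P (F t) (fun w => expR (lambda * E_enorm (c t w))) M).

Let S := E_argmin_set X l.
Let dist t w := E_dist_to S (x t w).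
Let alpha t := a / powR (u + t%:R) gamma.

Let S0 : S !=set0.
Proof. by have [C lC] := lipl; exact: (argmin_nonempty X0 clX bX lC). Qed.

Let cS : compact S.
Proof. by have [C lC] := lipl; exact: (argmin_compact clX bX lC). Qed.

Let Xx t w : X (x t w).
Proof. by case: t => [|t]; [exact: Xx0|have [] := step t w]. Qed.

Let sigF t : sigma_algebra setT (F t). Proof. exact: (FF.1 t).1. Qed.

Let measF t A : F t A -> measurable A. Proof. exact: (FF.1 t).2. Qed.

Let ut_gt0 t : 0 < u + t%:R. Proof. by rewrite ltr_pwDl. Qed.

Let alpha_gt0 t : 0 < alpha t.
Proof. by rewrite divr_gt0// powR_gt0. Qed.

(** The projection onto a convex set is 1-Lipschitz, so each coordinate of x_{t+1} is a Lipschitz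
    function of y_{t+1}. *)
Lemma iterate_measurable t : E_measurable_wrt (F t) (x t).
Proof.
elim: t => [//|t IH] i.
have mxt : E_measurable_wrt (F t.+1) (x t).
  by move=> j B mB; apply: (FF.2 t t.+1 (leqnSn t)); exact: IH.
pose Y w := x t w - alpha t *: c t w.
have mY : E_measurable_wrt (F t.+1) Y.
  move=> j; have -> : (fun w => Y w ord0 j) = (fun w => x t w ord0 j - alpha t * c t w ord0 j).
    by apply/funext => w; rewrite !mxE.
  apply: (sub_measurableB (sigF _)); first exact: mxt.
  by apply: (sub_measurableZ (sigF _)); exact: mc.
apply: (lipschitz_sub_measurable (sigF _) mY (L := 1)) => w w'.
rewrite mul1r; apply: le_trans (proj_nonexpansive cX (step t w) (step t w')).
by have := coord_le_enorm (x t.+1 w - x t.+1 w') i; rewrite !mxE; apply: le_trans; exact: ler_norm.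
Qed.

Let mlip t (f : Omega -> R) L : (forall w w', f w - f w' <= L * E_enorm (x t w - x t w')) ->
  measurable_fun setT f.
Proof.
move=> fL; apply: (sub_measurable_fun (FF.1 t)) => //.
exact: (lipschitz_sub_measurable (sigF t) (iterate_measurable t) fL).
Qed.

Let mdist t : measurable_fun setT (dist t).
Proof.
apply: (@mlip t _ 1) => w w'; rewrite mul1r lerBlDl; exact: dist_to_lipschitz.
Qed.

Let mexp t s : measurable_fun setT (fun w => (expR (s * dist t w))%:E).
Proof.
apply/measurable_EFinP; apply: measurableT_comp; first exact: measurable_expR.
by apply: measurable_funM => //; exact: mdist.
Qed.

Let dist_bounded : exists2 D, 0 <= D & forall t w, dist t w <= D.
Proof.
have [B XB] := bX; have [p Sp] := S0.
exists (`|B| + `|B|); first by rewrite addr_ge0.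
move=> t w; have [Xp _] := Sp.
apply: le_trans (dist_to_le _ Sp) _; apply: le_trans (enorm_triangle _ _) _.
rewrite enormN; apply: lerD; apply: le_trans (ler_norm B); exact: XB.
Qed.

Let M_ge1 : 1 <= M.
Proof.
have := D2 (t := 0%N) (sub_setT (sigF 0)); rewrite probability_setT mule1 => H.
rewrite -lee_fin; apply: le_trans H.
rewrite -(probability_setT P) -[leLHS]mul1e -integral_cst//.
apply: ge0_le_integral => //.
- apply/measurable_EFinP; apply: measurableT_comp; first exact: measurable_expR.
  apply: measurable_funM => //; apply: measurable_enorm => i _ B mB.
  by rewrite setTI; apply: (@measF 1); exact: mc.
- move=> w _; rewrite lee_fin -expR0 ler_expR mulr_ge0 ?enorm_ge0// ltW//.
Qed.

Let integral_cst_prob (k : R) : (\int[P]_w k%:E = k%:E)%E.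
Proof.
transitivity (k%:E * P setT)%E; first exact: integral_cst.
by rewrite probability_setT mule1.
Qed.

Lemma exp_moment_bound : exists I J : R, [/\ 0 < I, 0 < J &
  forall t, (\int[P]_w (expR (I * powR t%:R gamma * dist t.+1 w))%:E <= J%:E)%E].
Proof.
have [D D0 distD] := dist_bounded.
have M0 : 0 < M by apply: lt_le_trans M_ge1.
have [C2 C2E C20] : exists2 C2, C2 = 16 / lambda ^+ 2 & 0 < C2.
  by exists (16 / lambda ^+ 2); rewrite // divr_gt0// exprn_gt0.
(* Chosen so that [r^-1 * C2 * M = kappa / 4]. The last bound in [eta] supplies the other
   [kappa / 4], and its first two are the remaining smallness conditions of [one_step]. *)
pose r := 4 * C2 * M / kappa.
have r0 : 0 < r by rewrite divr_gt0// !mulr_gt0.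
pose eta := Num.min (lambda / 2) (Num.min kappa^-1 (kappa / (4 * C2 * M))).
have eta0 : 0 < eta by rewrite !lt_min invr_gt0 kappa0 /= !divr_gt0// !mulr_gt0.
have [eta1 eta2 eta3] : [/\ eta <= lambda / 2, eta <= kappa^-1 & eta <= kappa / (4 * C2 * M)].
  by rewrite /eta !ge_min !lexx !orbT.
(* With [B >= W], the harmonic sum over the window from [t / B] to [t] reaches
   [2 * D / (kappa * a)]. *)
pose W := (u + 2) * expR (2 * D / (kappa * a)).
have [N WN] : exists N : nat, W <= N.+1%:R.
  by exists (Num.truncn W); rewrite ltW// truncnS_gt.
set B := N.+1 in WN.
have B1 : 1 <= 2 * B%:R :> R.
  by rewrite -natrM -[leLHS]/(1%:R) ler_nat.
have B0 : 0 < B%:R :> R by rewrite ltr0n.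
(* The factor [2 * B] is the worst ratio of [(u + s)^gamma] to [(u + n)^gamma] over the window; it
   enters both [I] and the minimal contraction [mu0]. *)
pose I := eta / (2 * B%:R * a).
have I0 : 0 < I by rewrite divr_gt0// !mulr_gt0.
pose mu0 := eta / (2 * B%:R) * kappa / 2.
have mu00 : 0 < mu0 by rewrite !divr_gt0// mulr_gt0// divr_gt0// mulr_gt0.
(* [J1] serves for [t >= B]: 1 for the compensated initial value plus the stationary level. [J2] is
   the crude bound for [t < B], where [t^gamma <= t + 1 <= B]. *)
pose J1 := 1 + expR (eta * r) * M / mu0.
pose J2 := expR (I * B%:R * D).
have J10 : 0 < J1.
  rewrite ltr_pwDl// mulr_ge0 ?invr_ge0 ?(ltW mu00)//.
  by apply: mulr_ge0; [exact: expR_ge0|exact: ltW].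
have J20 : 0 < J2 by exact: expR_gt0.
exists I, (J1 + J2); split=> //; first exact: addr_gt0.
move=> t; have [tB|Bt] := ltnP t B.
  apply: (@le_trans _ _ (\int[P]_w J2%:E)%E).
    apply: ge0_le_integral => //.
    move=> w _; rewrite lee_fin ler_expR.
    apply: ler_pM; [by rewrite mulr_ge0 ?powR_ge0// ltW|exact: dist_to_ge0| |exact: distD].
    rewrite ler_pM2l//; apply: le_trans (powR_le_add1 gamma01 _) _ => //.
    by rewrite natr1 ler_nat.
  by rewrite integral_cst_prob lee_fin lerDr ltW.
pose n := (t %/ B)%N.
have n1 : (1 <= n)%N by rewrite divn_gt0.
have nt : (n * B <= t)%N by exact: leq_divM.
have tn : (t <= 2 * B * n)%N.
  have := ltn_ceil t (ltn0Sn N); rewrite -/B -/n => /ltnW/leq_trans; apply.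
  by rewrite mulnAC leq_mul2r mul2n -addnn -addn1 leq_add2l n1 orbT.
have nlet : (n <= t)%N by exact: leq_div.
have tnR : t%:R <= 2 * B%:R * n%:R :> R by rewrite -!natrM ler_nat.
have key s : (s <= t)%N -> powR (u + s%:R) gamma <= 2 * B%:R * powR (u + n%:R) gamma.
  move=> st; apply: powR_le_mul => //; [exact: ltW|exact: ltW|].
  have : s%:R <= t%:R :> R by rewrite ler_nat.
  have : 1 * u <= 2 * B%:R * u by rewrite ler_pM2r.
  lra.
(* This is [eta / alpha n]: since the steps decrease, [th * alpha s] is at most [eta] on the
   window. *)
pose th := eta * powR (u + n%:R) gamma / a.
have th0 : 0 < th by rewrite divr_gt0// mulr_gt0// powR_gt0.
have th_alpha s : th * alpha s = eta * (powR (u + n%:R) gamma / powR (u + s%:R) gamma).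
  by rewrite /th /alpha; field; rewrite !gt_eqF ?powR_gt0.
have h_hi s : (n <= s)%N -> th * alpha s <= eta.
  move=> ns; rewrite th_alpha -[leRHS]mulr1 ler_pM2l// ler_pdivrMr ?powR_gt0// mul1r.
  have /andP[g0 _] := gamma01.
  by apply: ge0_ler_powR; rewrite ?nnegrE ?(ltW (ut_gt0 _))// lerD2l ler_nat.
have h_lo s : (s <= t)%N -> eta / (2 * B%:R) <= th * alpha s.
  move=> st; rewrite th_alpha ler_pM2l// ler_pdivlMr ?powR_gt0// mulrC ler_pdivrMr ?mulr_gt0//.
  by rewrite mulrC; exact: key.
have alpha_lo s : a / (u + 1 + s%:R) <= alpha s.
  rewrite /alpha ler_pM2l// lef_pV2 ?posrE ?powR_gt0//; last by rewrite ltr_wpDr// addr_gt0.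
  apply: le_trans (powR_le_add1 gamma01 _) _; first exact: ltW.
  by lra.
pose Z i := (\int[P]_w (expR (th * dist (n + i) w))%:E)%E.
pose mu i := th * alpha (n + i) * kappa / 2.
have Zrec i : (i < t.+1 - n)%N ->
    (Z i.+1 <= (1 - mu i)%:E * Z i + (expR (eta * r) * M)%:E)%E.
  rewrite ltn_subRL ltnS => it.
  have h1 := h_hi _ (leq_addr i n).
  have h0 : 0 < th * alpha (n + i) by rewrite mulr_gt0.
  rewrite /Z addnS.
  have H := @one_step R _ Omega P (F (n + i)) (FF.1 _) d (x (n + i)) (c (n + i))
    (fun w => gradl (x (n + i) w)) S (dist (n + i).+1) kappa lambda M (alpha (n + i)) th r D.
  have := H (iterate_measurable _) S0 cS _ (cg _) (D2 (t := _)) _ (mdist _) _ (distD _)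
    kappa0 lambda0 (alpha_gt0 _) th0 r0 (le_trans h1 eta1) (le_trans h1 eta2).
  move=> {}H; apply: le_trans (H _ _ _ _) _.
  - move=> j _ A mA; rewrite setTI; apply: (@measF (n + i).+1); exact: mc.
  - by move=> w p Sp; exact: D1.
  - move=> w p Sp; apply: le_trans (dist_to_le _ Sp) _.
    exact: proj_dist_le cX (step _ _) Sp.1.
  - rewrite -C2E.
    have -> : (r^-1 + th * alpha (n + i)) * C2 * M = kappa / 4 + th * alpha (n + i) * (C2 * M).
      by rewrite /r; field; rewrite !gt_eqF.
    have : th * alpha (n + i) * (C2 * M) <= kappa / (4 * C2 * M) * (C2 * M).
      by rewrite ler_pM2r ?mulr_gt0//; exact: le_trans eta3.
    have -> : kappa / (4 * C2 * M) * (C2 * M) = kappa / 4 by field; rewrite !gt_eqF.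
    lra.
  - apply: leeD => //; rewrite lee_fin ler_pM2r// ler_expR ler_pM2r//.
have Z0 : (Z 0%N <= (expR (th * D))%:E)%E.
  rewrite /Z addn0; apply: (@le_trans _ _ (\int[P]_w (expR (th * D))%:E)%E).
    by apply: ge0_le_integral => // w _; rewrite lee_fin ler_expR ler_pM2l.
  by rewrite integral_cst_prob.
have muE i : (i < t.+1 - n)%N -> mu0 <= mu i <= 1.
  rewrite ltn_subRL ltnS => it; apply/andP; split.
    by rewrite /mu0 /mu ler_pM2r// ler_pM2r//; exact: h_lo.
  rewrite /mu; have := le_trans (h_hi _ (leq_addr i n)) eta2.
  rewrite -(ler_pM2r kappa0) mulVf ?gt_eqF//; lra.
have := affine_recursion mu00 _ (expR_ge0 _) Z0 muE Zrec.
move=> /(_ _)/le_trans ZB.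
have Zt : (Z (t.+1 - n)%N <= J1%:E)%E.
  apply: ZB; first by rewrite mulr_ge0 ?expR_ge0 ?ltW.
  (* It remains to see that the sum of the [mu i] is at least [th * D]; the factor [th] occurs on
     both sides and cancels. *)
  rewrite lee_fin lerD2r -expRD -[leRHS]expR0 ler_expR addrC subr_le0.
  have -> : \sum_(i < t.+1 - n) mu i = th * (kappa / 2) * \sum_(i < t.+1 - n) alpha (n + i).
    by rewrite mulr_sumr; apply: eq_bigr => i _; rewrite /mu; ring.
  rewrite -mulrA ler_pM2l//.
  have H1 : a * \sum_(i < t.+1 - n) (u + 1 + n%:R + i%:R)^-1 <= \sum_(i < t.+1 - n) alpha (n + i).
    rewrite mulr_sumr; apply: ler_sum => i _; apply: le_trans (alpha_lo _).
    by rewrite natrD !addrA.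
  apply: le_trans (_ : kappa / 2 * (a * \sum_(i < t.+1 - n) (u + 1 + n%:R + i%:R)^-1) <= _); last first.
    by rewrite ler_pM2l ?divr_gt0.
  suff H2 : 2 * D / (kappa * a) <= \sum_(i < t.+1 - n) (u + 1 + n%:R + i%:R)^-1.
    have : kappa / 2 * a * (2 * D / (kappa * a)) <= kappa / 2 * a * \sum_(i < t.+1 - n) (u + 1 + n%:R + i%:R)^-1.
      by rewrite ler_pM2l// mulr_gt0// divr_gt0.
    have -> : kappa / 2 * a * (2 * D / (kappa * a)) = D by field; rewrite !gt_eqF.
    by rewrite mulrA.
  have v0 : 0 < u + 1 + n%:R by rewrite ltr_pwDl// addr_gt0.
  rewrite -ler_expR; apply: le_trans (harmonic_expR _ v0).
  rewrite ler_pdivlMr//.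
  have nB : n%:R * B%:R <= t%:R :> R by rewrite -natrM ler_nat.
  have n1R : 1 <= n%:R :> R by rewrite ler1n.
  have -> : u + 1 + n%:R + (t.+1 - n)%:R = u + 2 + t%:R :> R.
    by rewrite natrB ?(leq_trans nlet)// -natr1; ring.
  set E := expR _ in W WN *.
  have E0 : 0 <= E by exact: expR_ge0.
  (* As [n >= 1], [u + 1 + n <= (u + 2) * n]; hence [E * (u + 1 + n) <= W * n <= B * n <= t]. *)
  have : E * (u + 1 + n%:R) <= E * ((u + 2) * n%:R).
    apply: ler_wpM2l => //.
    have : 0 <= (u + 1) * (n%:R - 1) by rewrite mulr_ge0 ?subr_ge0 ?addr_ge0// ltW.
    by lra.
  have : W * n%:R <= B%:R * n%:R by apply: ler_wpM2r.
  rewrite /W; have := u0; lra.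
apply: (@le_trans _ _ J1%:E); last by rewrite lee_fin lerDl ltW.
apply: le_trans Zt; rewrite /Z subnKC; last exact: leq_trans nlet _.
apply: ge0_le_integral => //.
move=> w _; rewrite lee_fin ler_expR; apply: ler_wpM2r; first exact: dist_to_ge0.
rewrite /I /th.
have : powR t%:R gamma <= 2 * B%:R * powR (u + n%:R) gamma.
  apply: powR_le_mul => //; first exact: ltW.
  have : 0 <= 2 * B%:R * u by rewrite !mulr_ge0// ltW.
  lra.
move=> H.
have -> : eta * powR (u + n%:R) gamma / a = eta / (2 * B%:R * a) * (2 * B%:R * powR (u + n%:R) gamma).
  by field; rewrite !gt_eqF.
by rewrite ler_pM2l.
Qed.

End psgd.

(** * Tail and mean estimates *)

Theorem theorem2 (R : realType) (d : nat)
  (X : set 'rV[R]_d) (l : 'rV[R]_d -> R) (gradl : 'rV[R]_d -> 'rV[R]_d)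
  (dT : measure_display) (Omega : measurableType dT) (P : probability Omega R)
  (F : nat -> set (set Omega))
  (x c : nat -> Omega -> 'rV[R]_d)
  (a u gamma kappa lambda M : R) :
  (* the feasible set *)
  X !=set0 -> closed X -> E_boundedR X -> E_convexR X ->
  E_lipschitz_on X l ->
  (* step sizes alpha_t = a / (u + t)^gamma *)
  0 < a -> 0 < u -> 0 <= gamma <= 1 ->
  (* PSGD *)
  E_filtration F ->
  (forall w, X (x 0%N w)) -> E_measurable_wrt (F 0%N) (x 0%N) ->
  (forall t, E_measurable_wrt (F t.+1) (c t)) ->
  (forall t, E_cond_exp_eq P (F t) (c t) (fun w => gradl (x t w))) ->
  (forall t w, E_is_proj X (x t w - (a / powR (u + t%:R) gamma) *: c t w)
                         (x t.+1 w)) ->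
  (* (D1) *)
  0 < kappa ->
  (forall y ys, X y -> E_argmin_set X l ys ->
     E_enorm (y - ys) = E_dist_to (E_argmin_set X l) y ->
     kappa * E_enorm (y - ys) <= E_dotv (gradl y) (y - ys)) ->
  (* (D2) *)
  0 < lambda ->
  (forall t, E_cond_exp_le P (F t) (fun w => expR (lambda * E_enorm (c t w))) M) ->
  exists J I K L : R, [/\ 0 < J, 0 < I, 0 < K & 0 < L] /\ [/\
    (forall (t : nat) (z : R), 0 <= z ->
       (P [set w | (z <= E_dist_to (E_argmin_set X l) (x t.+1 w))%R]
       <= (J * expR (- (I * powR t%:R gamma * z)))%R%:E)%E),
    (forall t : nat, (1 <= t)%N ->
       (\int[P]_w (E_dist_to (E_argmin_set X l) (x t.+1 w))%R%:E
       <= (K / powR t%:R gamma)%R%:E)%E) &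
    (forall t : nat, (1 <= t)%N ->
       (\int[P]_w (l (x t.+1 w) - E_min_val X l)%R%:E
       <= (L / powR t%:R gamma)%R%:E)%E)].
Proof.
move=> X0 clX bX cX lipl a0 u0 gamma01 FF Xx0 mx0 mc cg step kappa0 D1 lambda0 D2.
have [I [J [I0 J0 IJ]]] := exp_moment_bound X0 clX bX cX lipl a0 u0 gamma01 FF
  Xx0 mx0 mc cg step kappa0 D1 lambda0 D2.
have [C lC] := lipl.
set S := E_argmin_set X l in D1 IJ *.
have mx := iterate_measurable cX FF mx0 mc step.
have Xx t w : X (x t.+1 w) by have [] := step t w.
have mlip t (f : Omega -> R) L :
    (forall w w', f w - f w' <= L * E_enorm (x t w - x t w')) -> measurable_fun setT f.
  move=> fL; apply: (sub_measurable_fun (FF.1 t)) => //.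
  exact: (lipschitz_sub_measurable (FF.1 t).1 (mx t) fL).
have mdist t : measurable_fun setT (fun w => E_dist_to S (x t w)).
  by apply: (mlip t _ 1) => w w'; rewrite mul1r lerBlDl; exact: dist_to_lipschitz.
have mexp t s : measurable_fun setT (fun w => (expR (s * E_dist_to S (x t w)))%:E).
  apply/measurable_EFinP; apply: measurableT_comp; first exact: measurable_expR.
  exact: measurable_funM.
have tau_gt0 t : (1 <= t)%N -> 0 < powR t%:R gamma :> R.
  by move=> t1; rewrite powR_gt0// ltr0n.
have mean_dist t : (1 <= t)%N ->
    (\int[P]_w (E_dist_to S (x t.+1 w))%:E <= (J / I / powR t%:R gamma)%:E)%E.
  move=> /tau_gt0 t0; have It0 : 0 < I * powR t%:R gamma by rewrite mulr_gt0.
  (* Apply [y <= exp y] to [y = I * t^gamma * dist]. *)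
  apply: (@le_trans _ _ (\int[P]_w ((I * powR t%:R gamma)^-1%:E *
      (expR (I * powR t%:R gamma * E_dist_to S (x t.+1 w)))%:E))%E).
    apply: ge0_le_integral => //.
    - by move=> w _; rewrite lee_fin dist_to_ge0.
    - exact/measurable_EFinP.
    - exact: measurable_funeM.
    - move=> w _; rewrite -EFinM lee_fin ler_pdivlMl//.
      by apply: le_trans (expR_ge1Dx _); rewrite lerDr.
  rewrite ge0_integralZl//; last by rewrite lee_fin invr_ge0 ltW.
  have -> : J / I / powR t%:R gamma = (I * powR t%:R gamma)^-1 * J.
    by field; rewrite !gt_eqF.
  by rewrite EFinM; apply: lee_wpmul2l => //; rewrite lee_fin invr_ge0 ltW.
(* The constant [|C| + 1] keeps [L] positive whatever the sign of [C]. *)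
exists J, I, (J / I), ((`|C| + 1) * (J / I)); split.
  by split=> //; rewrite ?mulr_gt0 ?invr_gt0// ltr_wpDl.
split=> // [t z z0|t t1].
- set A := [set w | _]; set s := I * powR t%:R gamma.
  have mA : measurable A.
    have -> : A = setT `&` (fun w => E_dist_to S (x t.+1 w)) @^-1` `[z, +oo[.
      by apply/seteqP; split=> w; rewrite /A /= in_itv /= andbT => // -[].
    exact: mdist.
  have s0 : 0 <= s by rewrite mulr_ge0 ?powR_ge0// ltW.
  (* Markov's inequality: on [A] the exponential of [s] times the distance is at least
     [exp (s * z)]. *)
  rewrite expRN mulrC -/s -(lee_pmul2l (x := (expR (s * z))%:E)) ?lte_fin ?expR_gt0//.
  rewrite -EFinM mulVKf ?gt_eqF ?expR_gt0//.
  rewrite -integral_cst//; apply: le_trans (IJ t); rewrite -/s.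
  apply: (@le_trans _ _ (\int[P]_(w in A) (expR (s * E_dist_to S (x t.+1 w)))%:E)%E).
    apply: ge0_le_integral => //.
    - by move=> w _; rewrite lee_fin expR_ge0.
    - by apply: measurable_funTS; exact: mexp.
    - by move=> w Aw; rewrite lee_fin ler_expR ler_wpM2l.
  exact: ge0_subset_integral.
- apply: (@le_trans _ _ (\int[P]_w ((`|C| + 1)%:E * (E_dist_to S (x t.+1 w))%:E))%E).
    apply: ge0_le_integral => //.
    + by move=> w _; rewrite lee_fin; exact: (min_val_ge0 X0 clX bX lC).
    + apply/measurable_EFinP; apply: (mlip t.+1 _ C) => w w'.
      rewrite opprB addrA subrK; apply: le_trans (ler_norm _) _; exact: lC.
    + by apply: measurable_funeM; exact/measurable_EFinP.
    + move=> w _; rewrite -EFinM lee_fin.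
      apply: le_trans (min_val_le X0 clX bX lC (Xx t w)) _.
      by apply: ler_wpM2r; [exact: dist_to_ge0|rewrite lerDl].
  rewrite ge0_integralZl//; [|exact/measurable_EFinP|by move=> w _; rewrite lee_fin dist_to_ge0].
  rewrite -mulrA EFinM; apply: lee_wpmul2l; last exact: mean_dist.
  by rewrite lee_fin addr_ge0.
Qed.
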